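(* Let $\omega$ be a smooth $2$-form on $M=T^*\mathbb{R}^2$ such that the symplectic Monge-Ampère equation $\Delta_\omega=0$ is of divergent type, i.e. $d\bot d\omega=0$. Then there is a smooth function $\mu$ on $M$ such that, replacing $\omega$ by $\omega+\mu\Omega$ (which defines the same Monge-Ampère equation), $(\omega,\Omega)$ is a Hitchin pair, that is $d\omega=0$; consequently, with this $\omega$, with $A$ the endomorphism field defined by $\omega=\Omega(A\cdot,\cdot)$ and with $\tilde\omega=-\Omega((1+A^2)\cdot,\cdot)$, $$\mathbb{J}=\begin{pmatrix} A& \Omega^{-1}\\ \tilde{\omega} & -A^*\end{pmatrix}$$ is an integrable generalized complex structure on the $4$-dimensional manifold $M$.
   Context: $M=T^*\mathbb{R}^2$ with coordinates $(q_1,q_2,p_1,p_2)$ and symplectic form $\Omega=dq_1\wedge dp_1+dq_2\wedge dp_2$. For a $2$-form $\omega$ on $M$, the Monge-Ampère operator is $\Delta_\omega(f)=(df)^*\omega$ for $f\in C^\infty(\mathbb{R}^2)$, where $df:\mathbb{R}^2\to T^*\mathbb{R}^2$ is viewed as a section; since $(df)^*\Omega=0$, adding to $\omega$ a multiple $\mu\Omega$ does not change the operator. The operator $\bot:\Omega^k(M)\to\Omega^{k-2}(M)$ is contraction with the bivector dual to $\Omega$: $\bot\theta=\sum_j\iota_{\partial_{p_j}}\iota_{\partial_{q_j}}\theta$ (so $\bot\Omega=2$). The Euler operator is $\mathcal{E}(\omega)=d\bot d\omega$, and $\Delta_\omega=0$ is said to be of divergent type if $\mathcal{E}(\omega)=0$.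 A pair $(\omega,\Omega)$ of a $2$-form and a symplectic form with $d\omega=0$ is called a Hitchin pair. On $T\oplus T^*$ ($T=TM$) consider the pairing $(X+\xi,Y+\eta)=\frac12(\xi(Y)+\eta(X))$ and the Courant bracket $[X+\xi,Y+\eta]=[X,Y]+L_X\eta-L_Y\xi-\frac12 d(\iota_X\eta-\iota_Y\xi)$. An almost generalized complex structure is a bundle map $\mathbb{J}:T\oplus T^*\to T\oplus T^*$ with $\mathbb{J}^2=-1$ and $(\mathbb{J}\cdot,\cdot)=-(\cdot,\mathbb{J}\cdot)$; it is integrable (a generalized complex structure) if the spaces of sections of its two eigenbundles in $(T\oplus T^* )\otimes\mathbb{C}$ are closed under the Courant bracket. In the matrix, a $2$-form $\theta$ is viewed as the map $T\to T^*$, $X\mapsto\iota_X\theta$; $\Omega^{-1}:T^*\to T$ is the inverse of $X\mapsto\iota_X\Omega$; and $A^*$ is the dual endomorphism of $T^*$, $A^*\xi=\xi\circ A$. *)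

(* Defs.v *)
From mathcomp Require Import all_boot all_order all_algebra.
From mathcomp Require Import all_classical all_reals all_analysis.
From mathcomp.real_closed Require Import complex.

Set Implicit Arguments.
Unset Strict Implicit.
Unset Printing Implicit Defensive.

Import Order.TTheory GRing.Theory Num.Theory.
Import numFieldNormedType.Exports.

Local Open Scope ring_scope.

Definition partial {R : realType} {m : nat} (j : 'I_m) (f : 'rV[R]_m -> R) :
  'rV[R]_m -> R := fun x => 'D_(delta_mx 0 j) f x.

(* C^oo: all iterated partial derivatives exist and are (Frechet)
   differentiable. *)
Definition smooth {R : realType} {m : nat} (f : 'rV[R]_m -> R) : Prop :=
  forall (s : seq 'I_m) (x : 'rV[R]_m),
    differentiable (foldr partial f s) x.

(* The k tangent vectors fed to a k-form are the rows of a k x m matrix, so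
   that a form at a point is a function of matrices, like a determinant. *)
Definition dform (R : realType) (m k : nat) : Type :=
  'rV[R]_m -> 'M[R]_(k, m) -> R.

(* Row i0 of A is b.B_i0 + c.C_i0 and all the other rows of A, B, C agree. *)
Definition multilinear_form {R : realType} {m k : nat} (phi : 'M[R]_(k, m) -> R) :
  Prop :=
  forall (A B C : 'M[R]_(k, m)) (i0 : 'I_k) (b c : R),
    row i0 A = b *: row i0 B + c *: row i0 C ->
    row' i0 B = row' i0 A -> row' i0 C = row' i0 A ->
    phi A = b * phi B + c * phi C.

Definition alternating_form {R : realType} {m k : nat} (phi : 'M[R]_(k, m) -> R) :
  Prop :=
  forall (A : 'M[R]_(k, m)) (i1 i2 : 'I_k),
    i1 != i2 -> row i1 A = row i2 A -> phi A = 0.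

Definition smooth_form {R : realType} {m k : nat} (theta : dform R m k) : Prop :=
  [/\ forall x, multilinear_form (theta x),
      forall x, alternating_form (theta x)
    & forall v, smooth (fun x => theta x v)].

(* Invariant formula for d, without bracket terms: the rows of v are extended
   to constant, hence commuting, vector fields. *)
Definition ext_d {R : realType} {m k : nat} (theta : dform R m k) :
  dform R m k.+1 :=
  fun x v => \sum_(i < k.+1)
    (-1) ^+ i * 'D_(row i v) (fun y => theta y (row' i v)) x.

Definition closed_form {R : realType} {m k : nat} (theta : dform R m k) : Prop :=
  forall x v, ext_d theta x v = 0.

Definition int_prod {R : realType} {m k : nat} (X : 'rV[R]_m -> 'rV[R]_m)
  (theta : dform R m k.+1) : dform R m k :=
  fun x v => theta x (col_mx (X x) v).

Definition pullback {R : realType} {l m k : nat} (s : 'rV[R]_l -> 'rV[R]_m)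
  (theta : dform R m k) : dform R l k :=
  fun x v => theta (s x) (v *m 'J s x).

Definition nondegenerate_form {R : realType} {m : nat} (theta : dform R m 2) : Prop :=
  forall x (X : 'rV[R]_m),
    (forall Y : 'rV[R]_m, theta x (col_mx X Y) = 0) -> X = 0.

Definition symplectic_form {R : realType} {m : nat} (theta : dform R m 2) :
  Prop :=
  [/\ smooth_form theta, closed_form theta & nondegenerate_form theta].

Definition hitchin_pair {R : realType} {m : nat} (omega Omega : dform R m 2) :
  Prop :=
  [/\ smooth_form omega, symplectic_form Omega & closed_form omega].

(* On T^*R^n = R^(n + n) the coordinates are (q, p): lshift n j indexes q_j and
   rshift n j indexes p_j. *)
Definition qvec {R : realType} {n : nat} (j : 'I_n) : 'rV[R]_(n + n) :=
  delta_mx 0 (lshift n j).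

Definition pvec {R : realType} {n : nat} (j : 'I_n) : 'rV[R]_(n + n) :=
  delta_mx 0 (rshift n j).

(* sum_j dq_j /\ dp_j, with (a /\ b)(X, Y) = a(X) b(Y) - a(Y) b(X). *)
Definition canonical_form (R : realType) (n : nat) : dform R (n + n) 2 :=
  fun _ v => \sum_(j < n)
    (v 0 (lshift n j) * v 1 (rshift n j) - v 1 (lshift n j) * v 0 (rshift n j)).
Arguments canonical_form : clear implicits.

(* sum_j iota_(d/dp_j) iota_(d/dq_j) theta, i.e. theta(d/dq_j, d/dp_j, ...),
   so that bot of the canonical form is n. *)
Definition bot {R : realType} {n k : nat} (theta : dform R (n + n) k.+2) :
  dform R (n + n) k :=
  fun x v => \sum_(j < n)
    int_prod (fun=> pvec j) (int_prod (fun=> qvec j) theta) x v.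

Definition euler {R : realType} {n k : nat} (theta : dform R (n + n) k.+1) :
  dform R (n + n) k.+1 :=
  ext_d (bot (ext_d theta)).

Definition divergent_type {R : realType} {n : nat} (omega : dform R (n + n) 2) :
  Prop :=
  forall x v, euler omega x v = 0.

Definition df_section {R : realType} {n : nat} (f : 'rV[R]_n -> R) :
  'rV[R]_n -> 'rV[R]_(n + n) :=
  fun q => row_mx q (\row_j partial j f q).

Definition monge_ampere {R : realType} {n : nat} (omega : dform R (n + n) n)
  (f : 'rV[R]_n -> R) : dform R n n :=
  pullback (df_section f) omega.

Notation dual R m := 'Hom('rV[R]_m, R^o).

Definition TT (R : realType) (m : nat) : vectType R :=
  ('rV[R]_m * dual R m)%type.

Definition pairing {R : realType} {m : nat} (e f : TT R m) : R :=
  2^-1 * (e.2 f.1 + f.2 e.1).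

Definition smooth_section {R : realType} {m : nat} (e : 'rV[R]_m -> TT R m) :
  Prop :=
  (forall j, smooth (fun x => (e x).1 0 j)) /\
  (forall v, smooth (fun x => ((e x).2 v : R))).

Definition lie_bracket {R : realType} {m : nat} (X Y : 'rV[R]_m -> 'rV[R]_m) :
  'rV[R]_m -> 'rV[R]_m :=
  fun x => 'D_(X x) Y x - 'D_(Y x) X x.

(* (L_X eta)(Y) = X(eta(Y)) - eta([X, Y]), for Y constant *)
Definition lie_deriv {R : realType} {m : nat} (X : 'rV[R]_m -> 'rV[R]_m)
  (eta : 'rV[R]_m -> dual R m) : 'rV[R]_m -> dual R m :=
  fun x => linfun (fun Y : 'rV[R]_m =>
    'D_(X x) (fun y => (eta y Y : R)) x - eta x (lie_bracket X (fun=> Y) x)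
      : R^o).

Definition dfun {R : realType} {m : nat} (g : 'rV[R]_m -> R) :
  'rV[R]_m -> dual R m :=
  fun x => linfun (fun v : 'rV[R]_m => 'd g x v : R^o).

Definition courant {R : realType} {m : nat} (e f : 'rV[R]_m -> TT R m) :
  'rV[R]_m -> TT R m :=
  let X x := (e x).1 in let xi x := (e x).2 in
  let Y x := (f x).1 in let eta x := (f x).2 in
  fun x => (lie_bracket X Y x,
            lie_deriv X eta x - lie_deriv Y xi x
            - 2^-1 *: dfun (fun y => eta y (X y) - xi y (Y y) : R) x).

(* An element a + i b of the complexification of T + T^* is Complex a b. *)
Definition TTC (R : realType) (m : nat) : Type := complex (TT R m).

Definition scaleC {R : realType} {m : nat} (z : R[i]) (e : TTC R m) : TTC R m :=
  Complex (complex.Re z *: complex.Re e - complex.Im z *: complex.Im e)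
          (complex.Re z *: complex.Im e + complex.Im z *: complex.Re e).

Definition smooth_csection {R : realType} {m : nat} (e : 'rV[R]_m -> TTC R m) :
  Prop :=
  smooth_section (fun x => complex.Re (e x)) /\
  smooth_section (fun x => complex.Im (e x)).

(* Complex-bilinear extension of the Courant bracket *)
Definition courantC {R : realType} {m : nat} (e f : 'rV[R]_m -> TTC R m) :
  'rV[R]_m -> TTC R m :=
  let er x := complex.Re (e x) in let ei x := complex.Im (e x) in
  let fr x := complex.Re (f x) in let fi x := complex.Im (f x) in
  fun x => Complex (courant er fr x - courant ei fi x)
                   (courant er fi x + courant ei fr x).

(* Fibre at x of the z-eigenbundle of the complexification of J *)
Definition eigenbundle {R : realType} {m : nat}
  (J : 'rV[R]_m -> 'End(TT R m)) (z : R[i]) (x : 'rV[R]_m) (e : TTC R m) :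
  Prop :=
  Complex (J x (complex.Re e)) (J x (complex.Im e)) = scaleC z e.

Definition csection_of {R : realType} {m : nat}
  (L : 'rV[R]_m -> TTC R m -> Prop) (e : 'rV[R]_m -> TTC R m) : Prop :=
  smooth_csection e /\ forall x, L x (e x).

Definition courant_closed {R : realType} {m : nat}
  (L : 'rV[R]_m -> TTC R m -> Prop) : Prop :=
  forall e f, csection_of L e -> csection_of L f -> csection_of L (courantC e f).

(* The first clause says that the bundle map J is smooth. *)
Definition almost_gcs {R : realType} {m : nat}
  (J : 'rV[R]_m -> 'End(TT R m)) : Prop :=
  [/\ forall e, smooth_section e -> smooth_section (fun x => J x (e x)),
      forall x e, J x (J x e) = - e
    & forall x e f, pairing (J x e) f = - pairing e (J x f)].

Definition integrable_gcs {R : realType} {m : nat}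
  (J : 'rV[R]_m -> 'End(TT R m)) : Prop :=
  [/\ almost_gcs J, courant_closed (eigenbundle J 'i%C)
    & courant_closed (eigenbundle J (- 'i%C))].

(* X |-> iota_X theta *)
Definition flat {R : realType} {m : nat} (theta : dform R m 2) (x : 'rV[R]_m) :
  'Hom('rV[R]_m, dual R m) :=
  linfun (fun X : 'rV[R]_m =>
    linfun (fun Y : 'rV[R]_m => theta x (col_mx X Y) : R^o)).

(* theta(A ., .) *)
Definition twist {R : realType} {m : nat} (theta : dform R m 2)
  (A : 'rV[R]_m -> 'End('rV[R]_m)) : dform R m 2 :=
  fun x v => theta x (col_mx (A x (row 0 v)) (row 1 v)).

Definition omega_tilde {R : realType} {m : nat} (Omega : dform R m 2)
  (A : 'rV[R]_m -> 'End('rV[R]_m)) : dform R m 2 :=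
  fun x v => - twist Omega (fun y => \1 + (A y \o A y))%VF x v.

(* The block matrix (A, Omega^-1; omega_tilde, - A^* ) acting on X + xi, with
   A^* xi = xi \o A. Omega^-1 is the inverse linear map, a two-sided inverse
   since flat Omega x is bijective for a nondegenerate Omega. *)
Definition gcs_matrix {R : realType} {m : nat} (Omega : dform R m 2)
  (A : 'rV[R]_m -> 'End('rV[R]_m)) : 'rV[R]_m -> 'End(TT R m) :=
  fun x => linfun (fun e : TT R m =>
    (A x e.1 + ((flat Omega x)^-1)%VF e.2,
     flat (omega_tilde Omega A) x e.1 - (e.2 \o A x)%VF) : TT R m).

(* Main.v *)
From HB Require Import structures.
From mathcomp.real_closed Require Import complex.
Require Import Defs.
From mathcomp Require Import all_boot all_order all_algebra.
From mathcomp Require Import all_classical all_reals all_analysis.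
From mathcomp Require Import ring lra.

(** Why the theorem is true.

    In dimension 4 the map alpha |-> alpha /\ Omega from 1-forms to 3-forms is an
    isomorphism, whose inverse is the contraction bot (lefschetz_dim4).  So
    d omega = alpha /\ Omega with alpha = bot (d omega), and the divergent type
    hypothesis says that alpha is closed.  By the Poincare lemma alpha = - d mu, whence
    d (omega + mu Omega) = (alpha + d mu) /\ Omega = 0 (divergent_type_closed).  The
    Monge-Ampere operator does not see mu Omega because the section df is Lagrangian,
    by the symmetry of the Hessian of f (pullback_canonical_form).

    Write now omega for the corrected, closed form.  Since omega and Omega are both
    skew, A is self-adjoint for Omega; J^2 = -1 and the skewness of J for the pairing
    are then formal computations.  For integrability, the first component of the
    equation J e = z e, with z = i or z = - i, solves the covector part of e in terms of
    its vector part X as the contraction of X with z Omega - omega, and the second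
    component follows from z^2 = -1.  Both eigenbundles are therefore graphs of closed
    complex 2-forms (eigenbundle_graph).  Finally, the Courant bracket of X + i_X B and
    Y + i_Y B is [X, Y] + i_[X,Y] B, up to the contraction of d B with X and Y, so that
    such graphs are closed under the bracket (courant_closed_graph_form).

    The differential calculus behind this is elementary: smooth functions form an
    algebra stable under partial derivatives, second derivatives commute by two
    applications of the mean value theorem (derive_sym), and the potential mu is the
    integral of alpha along the rays from the origin, differentiated under the integral
    sign (poincare_lemma). *)

Set Implicit Arguments.
Unset Strict Implicit.
Unset Printing Implicit Defensive.

Import Order.TTheory GRing.Theory Num.Theory.
Import numFieldNormedType.Exports.

Local Open Scope ring_scope.

(** * Smooth functions and vector fields *)

Lemma smoothP {R : realType} {m : nat} (f : 'rV[R]_m -> R) :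
  smooth f <-> (forall x, differentiable f x) /\ forall j, smooth (partial j f).
Proof.
split=> [sf|[df sf]].
  split=> [|j s] x; first exact: (sf [::]).
  by have := sf (rcons s j) x; rewrite foldr_rcons.
by elim/last_ind => [//|s j _] x; rewrite foldr_rcons; exact: sf.
Qed.

Lemma smooth_differentiable {R : realType} {m : nat} (f : 'rV[R]_m -> R) x :
  smooth f -> differentiable f x.
Proof. by move=> /smoothP[]. Qed.

Lemma smooth_partial {R : realType} {m : nat} (f : 'rV[R]_m -> R) j :
  smooth f -> smooth (partial j f).
Proof. by move=> /smoothP[]. Qed.

Lemma smooth_derivable {R : realType} {m : nat} (f : 'rV[R]_m -> R) x v :
  smooth f -> derivable f x v.
Proof. by move=> sf; apply: diff_derivable; exact: smooth_differentiable. Qed.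

(** A coinduction principle: it replaces inductions on the order of differentiation,
    for which the Leibniz rule would have to be iterated. *)
Lemma smooth_coind {R : realType} {m : nat} (P : ('rV[R]_m -> R) -> Prop) :
  (forall f, P f -> (forall x, differentiable f x) /\ forall j, P (partial j f)) ->
  forall f, P f -> smooth f.
Proof.
move=> PP f Pf s; elim/last_ind: s f Pf => [|s j IHs] f Pf x.
  by have [+ _] := PP f Pf; apply.
by rewrite foldr_rcons; apply: IHs; have [_] := PP f Pf; apply.
Qed.

Lemma smooth_cst {R : realType} {m : nat} (c : R) : smooth (fun _ : 'rV[R]_m => c).
Proof.
apply: (@smooth_coind R m (fun f => exists a, f = cst a)); last by exists c.
move=> _ [a ->]; split=> [x|j]; first exact: differentiable_cst.
by exists 0; apply/funext => x; rewrite /partial derive_cst.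
Qed.

Lemma derive_coord {R : realType} {m : nat} (x v : 'rV[R]_m) (j : 'I_m) :
  'D_v (fun y : 'rV[R]_m => y 0 j) x = v 0 j.
Proof.
have dx : derivable (@id 'rV[R]_m) x v by exact: derivable_id.
by rewrite -[in RHS](derive_id x v) derive_mx // mxE.
Qed.

Lemma smooth_coord {R : realType} {m : nat} (j : 'I_m) :
  smooth (fun x : 'rV[R]_m => x 0 j).
Proof.
apply/smoothP; split=> [x|i]; first exact: differentiable_coord.
have -> : partial i (fun x : 'rV[R]_m => x 0 j) = cst ((delta_mx 0 i : 'rV[R]_m) 0 j).
  by apply/funext => x; exact: derive_coord.
exact: smooth_cst.
Qed.

(** Introduced only to be fed to smooth_coind: unlike the set of products of two smooth
    functions, the algebra they generate is visibly stable under partial derivatives. *)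
Inductive smooth_algebra {R : realType} {m : nat} : ('rV[R]_m -> R) -> Prop :=
| SmoothBase f of smooth f : smooth_algebra f
| SmoothAdd f g of smooth_algebra f & smooth_algebra g : smooth_algebra (f + g)
| SmoothMul f g of smooth_algebra f & smooth_algebra g : smooth_algebra (f * g).

Lemma smooth_algebra_smooth {R : realType} {m : nat} (f : 'rV[R]_m -> R) :
  smooth_algebra f -> smooth f.
Proof.
apply: smooth_coind => {}f; elim=> {f} [f sf|f g Af [df pf] Ag [dg pg]|f g Af [df pf] Ag [dg pg]].
- by split=> [x|j]; [exact: smooth_differentiable|apply/SmoothBase/smooth_partial].
- split=> [x|j]; first exact: differentiableD.
  have -> : partial j (f + g) = partial j f + partial j g.
    by apply/funext => x; rewrite /partial deriveD //; exact: diff_derivable.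
  exact: SmoothAdd.
- split=> [x|j]; first exact: differentiableM.
  have -> : partial j (f * g) = f * partial j g + g * partial j f.
    by apply/funext => x; rewrite /partial deriveM //; exact: diff_derivable.
  by apply: SmoothAdd; apply: SmoothMul.
Qed.

Lemma smoothD {R : realType} {m : nat} (f g : 'rV[R]_m -> R) :
  smooth f -> smooth g -> smooth (fun x => f x + g x).
Proof.
by move=> sf sg; apply: smooth_algebra_smooth; apply: SmoothAdd; apply: SmoothBase.
Qed.

Lemma smoothM {R : realType} {m : nat} (f g : 'rV[R]_m -> R) :
  smooth f -> smooth g -> smooth (fun x => f x * g x).
Proof.
by move=> sf sg; apply: smooth_algebra_smooth; apply: SmoothMul; apply: SmoothBase.
Qed.

Lemma smoothZ {R : realType} {m : nat} (c : R) (f : 'rV[R]_m -> R) :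
  smooth f -> smooth (fun x => c * f x).
Proof. by move=> sf; apply: smoothM => //; exact: smooth_cst. Qed.

Lemma smoothN {R : realType} {m : nat} (f : 'rV[R]_m -> R) :
  smooth f -> smooth (fun x => - f x).
Proof.
by move=> /(smoothZ (-1)); under [X in smooth X -> _]eq_fun do rewrite mulN1r.
Qed.

Lemma smoothB {R : realType} {m : nat} (f g : 'rV[R]_m -> R) :
  smooth f -> smooth g -> smooth (fun x => f x - g x).
Proof. by move=> sf sg; apply: smoothD => //; exact: smoothN. Qed.

Lemma smooth_sum {R : realType} {m : nat} {I : Type} (r : seq I)
    (F : I -> 'rV[R]_m -> R) :
  (forall i, smooth (F i)) -> smooth (fun x => \sum_(i <- r) F i x).
Proof.
move=> sF; elim: r => [|i r IHr].
  by under eq_fun do rewrite big_nil; exact: smooth_cst.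
by under eq_fun do rewrite big_cons; exact: smoothD.
Qed.

Lemma derive_partial {R : realType} {m : nat} (f : 'rV[R]_m -> R) x v :
  differentiable f x -> 'D_v f x = \sum_j v 0 j * partial j f x.
Proof.
move=> df; rewrite deriveE // [v in LHS]row_sum_delta linear_sum.
by apply: eq_bigr => j _; rewrite linearZ /= /partial deriveE.
Qed.

Definition smooth_field {R : realType} {m n : nat} (X : 'rV[R]_m -> 'rV[R]_n) : Prop :=
  forall j, smooth (fun x => X x 0 j).

Lemma smooth_field_differentiable {R : realType} {m n : nat}
    (X : 'rV[R]_m -> 'rV[R]_n) x :
  smooth_field X -> differentiable X x.
Proof.
move=> sX.
have -> : X = \sum_(j < n) (fun y => X y 0 j *: (delta_mx 0 j : 'rV[R]_n)).
  by apply/funext => y; rewrite fct_sumE -row_sum_delta.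
by apply: differentiable_sum => j; apply: differentiableZl; exact: smooth_differentiable.
Qed.

Lemma derive_field {R : realType} {m n : nat} (X : 'rV[R]_m -> 'rV[R]_n) x v j :
  smooth_field X -> ('D_v X x) 0 j = 'D_v (fun y => X y 0 j) x.
Proof.
move=> sX; rewrite derive_mx ?mxE //.
by apply: diff_derivable; exact: smooth_field_differentiable.
Qed.

Lemma smooth_derive {R : realType} {m : nat} (f : 'rV[R]_m -> R)
    (X : 'rV[R]_m -> 'rV[R]_m) :
  smooth f -> smooth_field X -> smooth (fun x => 'D_(X x) f x).
Proof.
move=> sf sX.
have -> : (fun x => 'D_(X x) f x) = (fun x => \sum_j X x 0 j * partial j f x).
  by apply/funext => x; rewrite derive_partial //; exact: smooth_differentiable.
by apply: smooth_sum => j; apply: smoothM; [exact: sX|exact: smooth_partial].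
Qed.

(** * The Poincare lemma for 1-forms and the symmetry of second derivatives *)

Lemma smooth_continuous {R : realType} {m : nat} (f : 'rV[R]_m -> R) :
  smooth f -> continuous f.
Proof. by move=> sf x; apply: differentiable_continuous; exact: smooth_differentiable. Qed.

Lemma continuous_fst {T U : topologicalType} : continuous (@fst T U).
Proof. by move=> p; exact: cvg_fst. Qed.

Lemma continuous_snd {T U : topologicalType} : continuous (@snd T U).
Proof. by move=> p; exact: cvg_snd. Qed.

Lemma continuous_sumr {R : realType} {T : topologicalType} {m : nat}
    (F : 'I_m -> T -> R) :
  (forall j, continuous (F j)) -> continuous (fun x => \sum_j F j x).
Proof. by move=> cF; apply: continuous_big => // ?; exact: add_continuous. Qed.

Lemma normr_coord {R : realType} {m : nat} (h : 'rV[R]_m) j : `|h 0 j| <= `|h|.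
Proof.
rewrite [leRHS]/Num.Def.normr /= mx_normrE.
exact: (le_bigmax _ (fun i : 'I_1 * 'I_m => `|h i.1 i.2|) (0, j)).
Qed.

Lemma is_derive_lineP {R : realType} {m : nat} (f : 'rV[R]_m -> R)
    (x v : 'rV[R]_m) (t d : R) :
  is_derive t 1 (fun s => f (x + s *: v)) d <-> is_derive (x + t *: v) v f d.
Proof.
have E : (fun h : R => h^-1 *: (((fun s => f (x + s *: v)) \o shift t) (h *: 1)
            - f (x + t *: v))) =
         (fun h : R => h^-1 *: ((f \o shift (x + t *: v)) (h *: v) - f (x + t *: v))).
  apply/funext => h /=; congr (_ *: (f _ - _)).
  by rewrite [h%:A]mulr1 scalerDl addrCA.
split=> -[df dE]; (apply: DeriveDef; first by move: df; rewrite /derivable E).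
- by rewrite -dE /derive E.
- by rewrite -dE /derive E.
Qed.

Lemma is_derive_line {R : realType} {m : nat} (f : 'rV[R]_m -> R)
    (x v : 'rV[R]_m) (t : R) :
  derivable f (x + t *: v) v ->
  is_derive t 1 (fun s => f (x + s *: v)) ('D_v f (x + t *: v)).
Proof. by move=> df; apply/is_derive_lineP; exact: derivableP. Qed.

(** By the mean value theorem along the segment from x to x + h, the error of the
    linear approximation is the sum of the h_j (g_j (c) - g_j (x)) for a point c of
    that segment, and continuity of the g_j makes it negligible. *)
Lemma continuous_gradient_differentiable {R : realType} {m : nat}
    (f : 'rV[R]_m -> R) (g : 'I_m -> 'rV[R]_m -> R) x :
  (forall y v, is_derive y v f (\sum_j v 0 j * g j y)) ->
  (forall j, continuous (g j)) -> differentiable f x.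
Proof.
move=> fg cg.
pose df (v : 'rV[R]_m) : R := \sum_j v 0 j * g j x.
have ldf : linear df.
  move=> a u v; rewrite /df scaler_sumr -big_split /=; apply: eq_bigr => j _.
  by rewrite !mxE mulrDl -mulrA.
pose L : {linear 'rV[R]_m -> R^o} := HB.pack df (GRing.isLinear.Build _ _ _ _ _ ldf).
have cL : continuous L.
  have : smooth df.
    by apply: smooth_sum => j; apply: smoothM; [exact: smooth_coord|exact: smooth_cst].
  exact: smooth_continuous.
have fL : f \o shift x = cst (f x) + L +o_ 0 id.
  apply/eqaddoP => e e0.
  have e' : 0 < e / m.+1%:R by rewrite divr_gt0.
  have neargh : \forall h \near (0 : 'rV[R]_m), forall j (k : 'rV[R]_m),
      `|k| <= `|h| -> `|g j (x + k) - g j x| <= e / m.+1%:R.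
    suff nearg j : \forall h \near (0 : 'rV[R]_m), forall k : 'rV[R]_m,
      `|k| <= `|h| -> `|g j (x + k) - g j x| <= e / m.+1%:R.
      exact: (@filter_forall _ _ _ _ _ nearg).
    have /cvgrPdist_le /(_ _ e') /nbhs_ballP[r /= r0 gr] := cg j x.
    apply/nbhs_ballP; exists r => //= h; rewrite -ball_normE /= sub0r normrN => hr k kh.
    rewrite distrC; apply: gr; rewrite -ball_normE /= opprD addrA subrr sub0r normrN.
    exact: le_lt_trans kh hr.
  near=> h.
  have gh : forall j (k : 'rV[R]_m), `|k| <= `|h| ->
      `|g j (x + k) - g j x| <= e / m.+1%:R by near: h; exact: neargh.
  have [t t01 ft] : exists2 t : R, t \in `]0, 1[ &
      f (x + h) - f x = \sum_j h 0 j * g j (x + t *: h).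
    have [t t01||t t01] := @MVT R (fun t => f (x + t *: h))
        (fun t => \sum_j h 0 j * g j (x + t *: h)) 0 1 ltr01.
    - have fd := fg (x + t *: h) h.
      rewrite -(@derive_val _ _ _ _ _ _ _ fd); apply: is_derive_line; exact: ex_derive.
    - apply: derivable_within_continuous => t _.
      have fd := fg (x + t *: h) h.
      have dline : is_derive t 1 (fun s => f (x + s *: h)) ('D_h f (x + t *: h)).
        by apply: is_derive_line; exact: ex_derive.
      exact: ex_derive.
    by rewrite scale1r scale0r addr0 subr0 mulr1 => E; exists t.
  have -> : (f \o shift x - (cst (f x) + L)) h
      = \sum_j h 0 j * (g j (x + t *: h) - g j x).
    under eq_bigr do rewrite mulrBr; rewrite sumrB -ft.
    by rewrite /= !fctE /= opprD addrA [h + x]addrC.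
  have gth j : `|g j (x + t *: h) - g j x| <= e / m.+1%:R.
    apply: gh; rewrite normrZ ler_piMl // ger0_norm.
      by move: t01; rewrite in_itv /= => /andP[_ /ltW].
    by move: t01; rewrite in_itv /= => /andP[/ltW].
  apply: (le_trans (ler_norm_sum _ _ _)).
  apply: (@le_trans _ _ (\sum_(j < m) `|h| * (e / m.+1%:R))).
    by apply: ler_sum => j _; rewrite normrM ler_pM // normr_coord.
  rewrite sumr_const card_ord -[_ *+ m]mulr_natl.
  move: (normr_ge0 h); set a := `|h| => a0.
  rewrite [leLHS](_ : _ = m%:R / m.+1%:R * (e * a)); last first.
    by rewrite -mulrA; congr (_ * _); rewrite mulrA mulrC [e * a]mulrC.
  rewrite ler_piMl // ?mulr_ge0 // ?(ltW e0) //.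
  by rewrite ler_pdivrMr // mul1r ler_nat.
have dL : 'd f x = L :> ('rV[R]_m -> R) by exact: diff_unique.
by apply/diff_locallyP; rewrite dL.
Unshelve. all: by end_near. Qed.

Lemma is_derive_dilate {R : realType} {m : nat} (f : 'rV[R]_m -> R) (t : R) (x v : 'rV[R]_m) :
  differentiable f (t *: x) ->
  is_derive x v (fun y => f (t *: y)) (t * 'D_v f (t *: x)).
Proof.
move=> df.
have E : (fun h : R => h^-1 *: (((fun y => f (t *: y)) \o shift x) (h *: v) - f (t *: x))) =
         (fun h : R => h^-1 *: ((f \o shift (t *: x)) (h *: (t *: v)) - f (t *: x))).
  by apply/funext => h /=; rewrite [t *: (_ + _)]scalerDr !scalerA [t * h]mulrC.
have dtv : derivable f (t *: x) (t *: v) by exact: diff_derivable.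
apply: DeriveDef; first by rewrite /derivable E.
rewrite [LHS](_ : _ = 'D_(t *: v) f (t *: x)) ?/derive ?E // -!/(derive _ _ _).
by rewrite !deriveE // linearZ.
Qed.

Lemma is_derive_translate {R : realType} {m : nat} (f : 'rV[R]_m -> R) (z x v : 'rV[R]_m) :
  derivable f (x + z) v -> is_derive x v (fun y => f (y + z)) ('D_v f (x + z)).
Proof.
have E : (fun h : R => h^-1 *: (((fun y => f (y + z)) \o shift x) (h *: v) - f (x + z))) =
         (fun h : R => h^-1 *: ((f \o shift (x + z)) (h *: v) - f (x + z))).
  by apply/funext => h /=; rewrite addrA.
by move=> df; apply: DeriveDef; rewrite /derivable /derive E.
Qed.

Lemma line_MVT {R : realType} {m : nat} (f : 'rV[R]_m -> R) (x v : 'rV[R]_m) (s : R) :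
  (forall y, derivable f y v) -> 0 < s ->
  exists2 c, c \in `]0, s[ & f (x + s *: v) - f x = s * 'D_v f (x + c *: v).
Proof.
move=> df s0.
have dg (t : R) : is_derive t 1 (fun t => f (x + t *: v)) ('D_v f (x + t *: v)).
  exact: is_derive_line.
have [|t t01 E] := @MVT R (fun t => f (x + t *: v))
    (fun t => 'D_v f (x + t *: v)) 0 s s0 (fun t _ => dg t).
  by apply: derivable_within_continuous => t _; have dgt := dg t; exact: ex_derive.
exists t => //; move: E; rewrite scale0r addr0 subr0 => ->; exact: mulrC.
Qed.

(** Two applications of the mean value theorem, along u to y |-> f (y + sv) - f (y),
    then along v to the derivative of f along u.  The second difference on the left is
    symmetric in u and v, hence the equality of the mixed derivatives in the limit. *)
Lemma second_difference {R : realType} {m : nat} (f : 'rV[R]_m -> R) (x u v : 'rV[R]_m) (s : R) :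
  smooth f -> 0 < s ->
  exists c d, [/\ c \in `]0, s[, d \in `]0, s[ &
    f (x + s *: u + s *: v) - f (x + s *: u) - (f (x + s *: v) - f x)
    = s * s * 'D_v ('D_u f) (x + c *: u + d *: v)].
Proof.
move=> sf s0.
pose g y := f (y + s *: v) - f y.
have dg y : is_derive y u g ('D_u f (y + s *: v) - 'D_u f y).
  apply: is_deriveB; last by apply: derivableP; exact: smooth_derivable.
  by apply: is_derive_translate; exact: smooth_derivable.
have [|c c0s gc] := @line_MVT R m g x u s _ s0; first by move=> y; have dgy := dg y.
have sDf : smooth ('D_u f).
  by apply: (@smooth_derive _ _ f (fun=> u)) => // j; exact: smooth_cst.
have [|d d0s fd] := @line_MVT R m ('D_u f) (x + c *: u) v s _ s0.
  by move=> y; exact: smooth_derivable.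
exists c, d; split=> //; rewrite -mulrA -fd.
transitivity (s * 'D_u g (x + c *: u)); first exact: gc.
congr (_ * _).
by have dgc := dg (x + c *: u); exact: derive_val.
Qed.

Lemma derive_sym {R : realType} {m : nat} (f : 'rV[R]_m -> R) (x u v : 'rV[R]_m) :
  smooth f -> 'D_v ('D_u f) x = 'D_u ('D_v f) x.
Proof.
move=> sf.
have sD w : smooth ('D_w f).
  by apply: (@smooth_derive _ _ f (fun=> w)) => // j; exact: smooth_cst.
have sDD w w' : smooth ('D_w' ('D_w f)).
  by apply: (@smooth_derive _ _ _ (fun=> w')) => // j; exact: smooth_cst.
apply/eqP; rewrite -subr_eq0 -normr_le0; apply/ler_addgt0Pl => e e0; rewrite addr0.
have e2 : 0 < e / 2 by rewrite divr_gt0.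
have /cvgrPdist_le /(_ _ e2) /nbhs_ballP[r1 /= r10 A1] := @smooth_continuous _ _ _ (sDD u v) x.
have /cvgrPdist_le /(_ _ e2) /nbhs_ballP[r2 /= r20 A2] := @smooth_continuous _ _ _ (sDD v u) x.
(* s is small enough for x + cu + dv to stay in both neighbourhoods *)
pose N := 1 + (`|u| + `|v|).
have N0 : 0 < N by rewrite ltr_wpDr // addr_ge0.
pose s := Num.min r1 r2 / N.
have s0 : 0 < s by rewrite divr_gt0 // lt_min r10.
have near_x c d w w' : c \in `]0, s[ -> d \in `]0, s[ ->
    `|w| + `|w'| = `|u| + `|v| -> `|x - (x + c *: w + d *: w')| < Num.min r1 r2.
  rewrite !in_itv /= => /andP[c0 cs] /andP[d0 ds] ww.
  rewrite -addrA opprD addrA subrr sub0r normrN.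
  apply: le_lt_trans (ler_normD _ _) _; rewrite !normrZ !gtr0_norm //.
  apply: (@le_lt_trans _ _ (s * (`|w| + `|w'|))).
    by rewrite mulrDr lerD // ler_wpM2r // ltW.
  by rewrite ww /s mulrAC ltr_pdivrMr // ltr_pM2l ?lt_min ?r10 // ltrDr.
have [c [d [c0 d0 E1]]] := @second_difference _ _ f x u v s sf s0.
have [c' [d' [c0' d0' E2]]] := @second_difference _ _ f x v u s sf s0.
have E : 'D_v ('D_u f) (x + c *: u + d *: v) = 'D_u ('D_v f) (x + c' *: v + d' *: u).
  have ss : s * s != 0 by rewrite mulf_neq0 // gt_eqF.
  rewrite [x + s *: v + s *: u]addrAC in E2.
  move: ('D_v ('D_u f) (x + c *: u + d *: v)) ('D_u ('D_v f) (x + c' *: v + d' *: u))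
    (f (x + s *: u + s *: v)) (f (x + s *: u)) (f (x + s *: v)) (f x) E1 E2.
  by move=> a b p q r w E1 E2; apply: (mulfI ss); rewrite -E1 -E2; ring.
have B1 : `|'D_v ('D_u f) x - 'D_v ('D_u f) (x + c *: u + d *: v)| <= e / 2.
  apply: A1; rewrite -ball_normE /=.
  by apply: lt_le_trans (near_x _ _ _ _ c0 d0 erefl) _; rewrite ge_min lexx.
have B2 : `|'D_u ('D_v f) x - 'D_u ('D_v f) (x + c' *: v + d' *: u)| <= e / 2.
  apply: A2; rewrite -ball_normE /=.
  apply: lt_le_trans (near_x _ _ _ _ c0' d0' (addrC _ _)) _.
  by rewrite ge_min lexx orbT.
move: ('D_v ('D_u f) (x + c *: u + d *: v)) ('D_u ('D_v f) (x + c' *: v + d' *: u))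
  ('D_v ('D_u f) x) ('D_u ('D_v f) x) E B1 B2.
move=> a b p q <- pa qa.
by rewrite -(subrKA a) (splitr e) (le_trans (ler_normD _ _)) // lerD // distrC.
Qed.

Lemma continuous_derivable_FTC {R : realType} (F f : R -> R) :
  (forall t : R, is_derive t 1 F (f t)) -> continuous f ->
  (\int[lebesgue_measure]_(t in `[0%R, 1%R]) f t)%R = F 1 - F 0.
Proof.
move=> dF cf.
have cF : continuous F.
  by move=> t; apply/differentiable_continuous/derivable1_diffP; have dFt := dF t.
rewrite /Rintegral (@continuous_FTC2 _ f F) //.
- exact: continuous_subspaceT.
- split; first by move=> t _; have dFt := dF t.
    exact/cvg_at_right_filter/cF.
  exact/cvg_at_left_filter/cF.
- by move=> t _; rewrite derive1E; have dFt := dF t; exact: derive_val.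
Qed.

(** The case of the theorem of differentiation under the integral sign where the
    domination comes from compactness. *)
Lemma derive_integral01 {R : realType} (f df : R -> R -> R) (s : R) :
  (forall s t : R, is_derive s 1 (f^~ t) (df s t)) ->
  (forall s, continuous (f s)) -> continuous (fun p : R * R => df p.1 p.2) ->
  is_derive s 1 (fun s => (\int[lebesgue_measure]_(t in `[0%R, 1%R]) f s t)%R)
    (\int[lebesgue_measure]_(t in `[0%R, 1%R]) df s t)%R.
Proof.
move=> fdf cf cdf.
have int01 (g : R -> R) : continuous g ->
    lebesgue_measure.-integrable `[0%R, 1%R]%classic (EFin \o g).
  move=> cg; apply: continuous_compact_integrable; first exact: segment_compact.
  exact: continuous_subspaceT.
pose K := (`[s - 1, s + 1] `*` `[0%R, 1%R])%classic : set (R * R).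
have [c _ cmax] : exists2 c, c \in K & forall p, p \in K -> `|df p.1 p.2| <= `|df c.1 c.2|.
  apply: (@compact_EVT_max _ _ (fun p : R * R => `|df p.1 p.2|)).
  - exists (s, 0); split => /=; rewrite in_itv /= ?lexx ?ler01 //.
    by rewrite lerBlDr lerDl ler01.
  - by apply: compact_setX; exact: segment_compact.
  - apply: continuous_subspaceT => p; apply: continuous_comp; first exact: cdf.
    exact: norm_continuous.
have partialE r t : partial1of2 f r t = df r t.
  by rewrite partial1of2E; have := fdf r t => ?; exact: derive_val.
have s_in : s \in `]s - 1, s + 1[ by rewrite in_itv /= gtrBl ltrDl ltr01.
have f_int r : r \in `]s - 1, s + 1[ ->
    lebesgue_measure.-integrable `[0%R, 1%R]%classic (EFin \o f r).
  by move=> _; exact: int01.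
have f_der r t : r \in `]s - 1, s + 1[ -> t \in `[0%R, 1%R] -> derivable (f^~ t) r 1.
  by move=> _ _; have fd := fdf r t; exact: ex_derive.
have f_ub r t : r \in `]s - 1, s + 1[ -> t \in `[0%R, 1%R] ->
    `|partial1of2 f r t| <= cst (`|df c.1 c.2|) t.
  move=> rs t01; rewrite partialE; apply: (cmax (r, t)); rewrite inE; split => //=.
  exact: subset_itv_oo_cc.
have c_int := int01 _ (@cst_continuous _ _ (`|df c.1 c.2|)).
have mI : measurable (`[0%R, 1%R]%classic : set (measurableTypeR R)) by [].
apply: DeriveDef.
  exact: (@derivable_under_integral _ _ _ _ _ _ mI _ _ _ s_in f_int f_der _
    (fun=> normr_ge0 _) c_int f_ub).
rewrite -derive1E.
rewrite (differentiation_under_integral mI s_in f_int f_der (fun=> normr_ge0 _) c_int f_ub).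
by apply: eq_Rintegral => t _; exact: partialE.
Qed.

(** The primitive is mu (x) = int_0^1 sum_j x_j alpha_j (t x) dt.  By closedness, its
    derivative along v is the integral of the t-derivative of
    t * sum_j v_j alpha_j (t x), that is sum_j v_j alpha_j (x). *)
Lemma poincare_lemma {R : realType} {m : nat} (alpha : 'I_m -> 'rV[R]_m -> R) :
  (forall j, smooth (alpha j)) ->
  (forall i j x, partial i (alpha j) x = partial j (alpha i) x) ->
  exists2 mu : 'rV[R]_m -> R, smooth mu & forall j, partial j mu = alpha j.
Proof.
move=> sa ca.
pose mu (x : 'rV[R]_m) : R :=
  (\int[lebesgue_measure]_(t in `[0%R, 1%R]) \sum_j x 0 j * alpha j (t *: x))%R.
have dilate_cont j (x : 'rV[R]_m) : continuous (fun t : R => alpha j (t *: x)).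
  move=> t; apply: (@continuous_comp _ _ _ (fun t : R => t *: x)).
    exact: scalel_continuous.
  by apply: smooth_continuous.
have dmu (x v : 'rV[R]_m) : is_derive x v mu (\sum_j v 0 j * alpha j x).
  (* the integrand along the line through x directed by v, and its s-derivative *)
  pose f (s t : R) := \sum_j (x + s *: v) 0 j * alpha j (t *: (x + s *: v)).
  pose df (s t : R) := \sum_j ((x + s *: v) 0 j * (t * 'D_v (alpha j) (t *: (x + s *: v)))
     + v 0 j * alpha j (t *: (x + s *: v))).
  have dilate_der (y : 'rV[R]_m) t : is_derive y v (fun y => \sum_j y 0 j * alpha j (t *: y))
      (\sum_j (y 0 j * (t * 'D_v (alpha j) (t *: y)) + v 0 j * alpha j (t *: y))).
    have -> : (fun y : 'rV[R]_m => \sum_j y 0 j * alpha j (t *: y)) =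
        \sum_j ((fun y : 'rV[R]_m => y 0 j) * (fun y => alpha j (t *: y))).
      by apply/funext => z; rewrite fct_sumE.
    apply: is_derive_sum => j.
    have d1 := is_derive_dilate v (smooth_differentiable (t *: y) (sa j)).
    have d2 : is_derive y v (fun y : 'rV[R]_m => y 0 j) (v 0 j).
      by rewrite -(derive_coord y v j); apply/derivableP/diff_derivable/differentiable_coord.
    by apply: is_derive_eq; rewrite [v 0 j * _]mulrC.
  have fdf (s t : R) : is_derive s 1 (f^~ t) (df s t).
    exact: (is_derive_lineP (fun y => \sum_j y 0 j * alpha j (t *: y)) _ _ _ _).2 (dilate_der _ _).
  have cf s : continuous (f s).
    apply: continuous_sumr => j t; apply: cvgMl_tmp; exact: dilate_cont.
  have cdf : continuous (fun p : R * R => df p.1 p.2).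
    have cline : continuous (fun p : R * R => x + p.1 *: v).
      move=> p; apply: cvgD; first exact: cvg_cst.
      by apply: cvgZr_tmp; exact: continuous_fst.
    have cdil : continuous (fun p : R * R => p.2 *: (x + p.1 *: v)).
      by move=> p; apply: cvgZ; [exact: continuous_snd|exact: cline].
    apply: continuous_sumr => j p; apply: cvgD; apply: cvgM.
    - have sc := smooth_continuous (@smooth_coord R m j).
      exact: (continuous_comp (cline p) (sc _)).
    - apply: cvgM; first exact: continuous_snd.
      have sD : smooth ('D_v (alpha j)).
        by apply: (@smooth_derive _ _ _ (fun=> v)) => // i; exact: smooth_cst.
      exact: (continuous_comp (cdil p) (@smooth_continuous _ _ _ sD _)).
    - exact: cvg_cst.
    - exact: (continuous_comp (cdil p) (@smooth_continuous _ _ _ (sa j) _)).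
  have closed_sum y : \sum_j v 0 j * 'D_x (alpha j) y = \sum_j x 0 j * 'D_v (alpha j) y.
    under eq_bigr => j _ do
      rewrite (derive_partial x (smooth_differentiable y (sa j))) big_distrr /=.
    rewrite exchange_big /=; apply: eq_bigr => i _.
    rewrite (derive_partial v (smooth_differentiable y (sa i))) big_distrr /=.
    by apply: eq_bigr => j _; rewrite ca mulrCA.
  have int_df : (\int[lebesgue_measure]_(t in `[0%R, 1%R]) df 0 t)%R = \sum_j v 0 j * alpha j x.
    (* df 0 is the derivative of t G (t), by closedness *)
    pose G (t : R) := \sum_j v 0 j * alpha j (t *: x).
    have dG (t : R) : is_derive t 1 G (\sum_j v 0 j * 'D_x (alpha j) (t *: x)).
      have -> : G = \sum_j (v 0 j *: (fun t : R => alpha j (0 + t *: x))).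
        apply/funext => r; rewrite fct_sumE; apply: eq_bigr => j _.
        by rewrite -[r *: x in LHS]add0r.
      apply: is_derive_sum => j; apply: is_deriveZ.
      by apply/is_derive_lineP; rewrite add0r; apply: derivableP; exact: smooth_derivable.
    have dF (t : R) : is_derive t 1 (fun t => t * G t) (df 0 t).
      have dM : is_derive t 1 (@id R * G)
        (t *: (\sum_j v 0 j * 'D_x (alpha j) (t *: x)) + G t *: 1) by exact: is_deriveM.
      apply: (is_derive_eq dM); rewrite /df scale0r addr0 closed_sum big_split /=.
      congr (_ + _); last exact: mulr1.
      by rewrite scaler_sumr; apply: eq_bigr => j _; rewrite mulrCA.
    rewrite (continuous_derivable_FTC dF); last first.
      have cpair : continuous (fun t : R => ((0 : R), t)).
        by move=> t; exact: (cvg_pair (cvg_cst _) cvg_id).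
      by move=> t; exact: (continuous_comp (cpair t) (cdf _)).
    by rewrite mul1r mul0r subr0 /G; under eq_bigr do rewrite scale1r.
  have line0 := derive_integral01 0 fdf cf cdf; rewrite int_df in line0.
  by have := (is_derive_lineP mu x v 0 _).1 line0; rewrite scale0r addr0.
have sgrad y : differentiable mu y.
  apply: (@continuous_gradient_differentiable _ _ mu alpha y dmu) => j.
  exact: smooth_continuous.
have pmu j : partial j mu = alpha j.
  apply/funext => x; rewrite /partial; have dmux := dmu x (delta_mx 0 j).
  rewrite derive_val (bigD1 j) //= mxE !eqxx mul1r big1 ?addr0 // => i ij.
  by rewrite mxE (negbTE ij) andbF mul0r.
exists mu => //; apply/smoothP; split=> // j; rewrite pmu; exact: sa.
Qed.

(** * Two-forms *)

Lemma row0_col_mx {R : realType} {m : nat} (u v : 'rV[R]_m) :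
  row 0 (col_mx u v : 'M[R]_(2, m)) = u.
Proof.
apply/rowP => j; rewrite mxE -[RHS](col_mxEu u v); congr (col_mx u v _ j).
exact: val_inj.
Qed.

Lemma row1_col_mx {R : realType} {m : nat} (u v : 'rV[R]_m) :
  row 1 (col_mx u v : 'M[R]_(2, m)) = v.
Proof.
apply/rowP => j; rewrite mxE -[RHS](col_mxEd u v); congr (col_mx u v _ j).
exact: val_inj.
Qed.

Lemma row'0_mx {R : realType} {m : nat} (A : 'M[R]_(2, m)) : row' 0 A = row 1 A.
Proof.
by apply/matrixP => i j; rewrite !mxE; congr (A _ j); apply: val_inj; rewrite ord1.
Qed.

Lemma row'1_mx {R : realType} {m : nat} (A : 'M[R]_(2, m)) : row' 1 A = row 0 A.
Proof.
by apply/matrixP => i j; rewrite !mxE; congr (A _ j); apply: val_inj; rewrite ord1.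
Qed.

Lemma col_mx_rows {R : realType} {m : nat} (A : 'M[R]_(2, m)) :
  col_mx (row 0 A) (row 1 A) = A.
Proof.
apply/row_matrixP => i; case: (unliftP 0 i) => [k|] ->; last exact: row0_col_mx.
by rewrite ord1 (_ : lift 0 0 = 1) ?row1_col_mx //; exact: val_inj.
Qed.

Section TwoFormAtPoint.
Variables (R : realType) (m : nat) (phi : 'M[R]_(2, m) -> R).
Hypothesis phi_lin : multilinear_form phi.
Local Notation B u v := (phi (@col_mx R 1 1 m u v)).

Lemma form2_linearl (a : R) (u u' v : 'rV[R]_m) :
  B (a *: u + u') v = a * B u v + B u' v.
Proof.
rewrite (phi_lin (A := col_mx (a *: u + u') v) (B := col_mx u v) (C := col_mx u' v)
  (i0 := 0) (b := a) (c := 1)) ?mul1r // ?row0_col_mx ?scale1r //.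
- by rewrite !row'0_mx !row1_col_mx.
- by rewrite !row'0_mx !row1_col_mx.
Qed.

Lemma form2_linearr (a : R) (u v v' : 'rV[R]_m) :
  B u (a *: v + v') = a * B u v + B u v'.
Proof.
rewrite (phi_lin (A := col_mx u (a *: v + v')) (B := col_mx u v) (C := col_mx u v')
  (i0 := 1) (b := a) (c := 1)) ?mul1r // ?row1_col_mx ?scale1r //.
- by rewrite !row'1_mx !row0_col_mx.
- by rewrite !row'1_mx !row0_col_mx.
Qed.

Lemma form2Dl (u u' v : 'rV[R]_m) : B (u + u') v = B u v + B u' v.
Proof. by have := form2_linearl 1 u u' v; rewrite scale1r mul1r. Qed.

Lemma form2Dr (u v v' : 'rV[R]_m) : B u (v + v') = B u v + B u v'.
Proof. by have := form2_linearr 1 u v v'; rewrite scale1r mul1r. Qed.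

Lemma form20l (v : 'rV[R]_m) : B 0 v = 0.
Proof. by apply: (addrI (B 0 v)); rewrite -form2Dl !addr0. Qed.

Lemma form20r (u : 'rV[R]_m) : B u 0 = 0.
Proof. by apply: (addrI (B u 0)); rewrite -form2Dr !addr0. Qed.

Lemma form2Zl (a : R) (u v : 'rV[R]_m) : B (a *: u) v = a * B u v.
Proof. by have := form2_linearl a u 0 v; rewrite form20l !addr0. Qed.

Lemma form2Zr (a : R) (u v : 'rV[R]_m) : B u (a *: v) = a * B u v.
Proof. by have := form2_linearr a u v 0; rewrite form20r !addr0. Qed.

Lemma form2Nl (u v : 'rV[R]_m) : B (- u) v = - B u v.
Proof. by rewrite -scaleN1r form2Zl mulN1r. Qed.

Lemma form2Bl (u u' v : 'rV[R]_m) : B (u - u') v = B u v - B u' v.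
Proof. by rewrite form2Dl form2Nl. Qed.

Lemma form2_coordE (u v : 'rV[R]_m) :
  B u v = \sum_i \sum_j u 0 i * v 0 j * B (delta_mx 0 i) (delta_mx 0 j).
Proof.
rewrite [u in LHS]row_sum_delta.
rewrite (big_morph (fun u => B u v) (fun _ _ => form2Dl _ _ _) (form20l _)).
apply: eq_bigr => i _; rewrite form2Zl [v in LHS]row_sum_delta.
rewrite (big_morph (fun v => B _ v) (fun _ _ => form2Dr _ _ _) (form20r _)).
by rewrite big_distrr /=; apply: eq_bigr => j _; rewrite form2Zr mulrA.
Qed.

Hypothesis phi_alt : alternating_form phi.

Lemma form2_alt (u : 'rV[R]_m) : B u u = 0.
Proof. by apply: (phi_alt (i1 := 0) (i2 := 1)); rewrite // row0_col_mx row1_col_mx. Qed.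

Lemma form2_anti (u v : 'rV[R]_m) : B u v = - B v u.
Proof.
apply/eqP; rewrite -addr_eq0; apply/eqP; have := form2_alt (u + v).
by rewrite form2Dl !form2Dr !form2_alt addr0 add0r.
Qed.

End TwoFormAtPoint.

Definition comp2 {R : realType} {m : nat} (theta : dform R m 2) (i j : 'I_m) :
  'rV[R]_m -> R := fun x => theta x (@col_mx R 1 1 m (delta_mx 0 i) (delta_mx 0 j)).

Lemma smooth_form2 {R : realType} {m n : nat} (theta : 'rV[R]_n -> 'M[R]_(2, m) -> R)
    (X Y : 'rV[R]_n -> 'rV[R]_m) :
  (forall x, multilinear_form (theta x)) -> (forall v, smooth (theta^~ v)) ->
  smooth_field X -> smooth_field Y -> smooth (fun x => theta x (col_mx (X x) (Y x))).
Proof.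
move=> lt st sX sY.
under eq_fun do rewrite (form2_coordE (lt _)).
apply: smooth_sum => i; apply: smooth_sum => j; apply: smoothM; last exact: st.
by apply: smoothM; [exact: sX|exact: sY].
Qed.

(** The Leibniz rule for a bilinear form with variable coefficients and arguments. *)
Lemma derive_form2 {R : realType} {m : nat} (theta : dform R m 2)
    (X Y : 'rV[R]_m -> 'rV[R]_m) (x w : 'rV[R]_m) :
  smooth_form theta -> smooth_field X -> smooth_field Y ->
  'D_w (fun y => theta y (col_mx (X y) (Y y))) x =
    'D_w (fun y => theta y (col_mx (X x) (Y x))) x
    + (theta x (col_mx ('D_w X x) (Y x)) + theta x (col_mx (X x) ('D_w Y x))).
Proof.
move=> [lt _ st] sX sY.
pose b := comp2 theta.
have D (Z T : 'rV[R]_m -> 'rV[R]_m) : smooth_field Z -> smooth_field T ->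
    'D_w (fun y => theta y (col_mx (Z y) (T y))) x = \sum_i \sum_j
      (Z x 0 i * T x 0 j * 'D_w (b i j) x
        + (('D_w Z x) 0 i * T x 0 j + Z x 0 i * ('D_w T x) 0 j) * b i j x).
  move=> sZ sT.
  have -> : (fun y => theta y (col_mx (Z y) (T y))) =
      \sum_i \sum_j ((fun y => Z y 0 i * T y 0 j) * b i j).
    apply/funext => y; rewrite (form2_coordE (lt y)) fct_sumE.
    by apply: eq_bigr => i _; rewrite fct_sumE.
  have sZT i j : smooth (fun y => Z y 0 i * T y 0 j) by apply: smoothM.
  have sb i j : smooth (b i j) by exact: st.
  have dZT i j : derivable (fun y => Z y 0 i * T y 0 j) x w by exact: smooth_derivable.
  have db i j : derivable (b i j) x w by exact: smooth_derivable.
  rewrite derive_sum; last by move=> i; apply: derivable_sum => j; exact: derivableM.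
  apply: eq_bigr => i _; rewrite derive_sum; last by move=> j; exact: derivableM.
  apply: eq_bigr => j _; rewrite deriveM //.
  rewrite (derive_field _ _ _ sZ) (derive_field _ _ _ sT).
  have -> : 'D_w (fun y => Z y 0 i * T y 0 j) x =
      Z x 0 i * 'D_w (fun y => T y 0 j) x + T x 0 j * 'D_w (fun y => Z y 0 i) x.
    by rewrite (deriveM (f := fun y => Z y 0 i)) //; exact: smooth_derivable.
  rewrite /GRing.scale /=; ring.
have sc (c : 'rV[R]_m) : smooth_field (fun _ : 'rV[R]_m => c).
  by move=> j; exact: smooth_cst.
rewrite (D _ _ sX sY) (D _ _ (sc (X x)) (sc (Y x))) !(form2_coordE (lt x)).
rewrite -!big_split; apply: eq_bigr => i _; rewrite -!big_split; apply: eq_bigr => j _ /=.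
rewrite !derive_cst !mxE -[theta x _]/(b i j x) mul0r mulr0 addr0 mul0r addr0.
by rewrite mulrDl.
Qed.

Lemma row'_row3 {R : realType} {m : nat} (v : 'M[R]_(3, m)) :
  [/\ row' 0 v = col_mx (row 1 v) (row 2%:R v), row' 1 v = col_mx (row 0 v) (row 2%:R v)
    & row' 2%:R v = col_mx (row 0 v) (row 1 v)].
Proof.
by split; rewrite -[LHS]col_mx_rows; apply: (f_equal2 (@col_mx R 1 1 m));
  apply/rowP => j; rewrite !mxE; congr (v _ j); apply: val_inj.
Qed.

Lemma big_ord3 {R : realType} (F : 'I_3 -> R) : \sum_i F i = F 0 + F 1 + F 2%:R.
Proof.
rewrite !big_ord_recl big_ord0 addr0 addrA.
by congr (F _ + F _ + F _); exact: val_inj.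
Qed.

Lemma ext_d2E {R : realType} {m : nat} (theta : dform R m 2) x (v : 'M[R]_(3, m)) :
  ext_d theta x v =
    'D_(row 0 v) (fun y => theta y (col_mx (row 1 v) (row 2%:R v))) x
    - 'D_(row 1 v) (fun y => theta y (col_mx (row 0 v) (row 2%:R v))) x
    + 'D_(row 2%:R v) (fun y => theta y (col_mx (row 0 v) (row 1 v))) x.
Proof.
rewrite /ext_d big_ord3 /=; have [-> -> ->] := row'_row3 v.
by rewrite expr0 mul1r expr1 mulN1r sqrrN expr1n mul1r.
Qed.

Lemma row_col_mx3 {R : realType} {m : nat} (u v w : 'rV[R]_m) :
  let A : 'M[R]_(3, m) := col_mx u (col_mx v w) in
  [/\ row 0 A = u, row 1 A = v & row 2%:R A = w].
Proof.
split; apply/rowP => j; rewrite mxE.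
- by rewrite -[RHS](col_mxEu u (col_mx v w)); congr (col_mx u _ _ j); exact: val_inj.
- rewrite -[RHS](col_mxEu v w) -[RHS](col_mxEd u).
  by congr (col_mx u _ _ j); exact: val_inj.
- rewrite -[RHS](col_mxEd v w) -[RHS](col_mxEd u).
  by congr (col_mx u _ _ j); exact: val_inj.
Qed.

Lemma ext_d2_col_mx {R : realType} {m : nat} (theta : dform R m 2) x (u v w : 'rV[R]_m) :
  ext_d theta x (col_mx u (col_mx v w)) =
    'D_u (fun y => theta y (col_mx v w)) x - 'D_v (fun y => theta y (col_mx u w)) x
    + 'D_w (fun y => theta y (col_mx u v)) x.
Proof. by rewrite ext_d2E; have [-> -> ->] := row_col_mx3 u v w. Qed.

Lemma derive_form2_coordE {R : realType} {m : nat} (theta : dform R m 2)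
    x (u v w : 'rV[R]_m) :
  smooth_form theta ->
  'D_u (fun y => theta y (col_mx v w)) x = \sum_i \sum_j \sum_k
    u 0 i * v 0 j * w 0 k *
      partial i (comp2 theta j k) x.
Proof.
move=> [lt _ st].
rewrite derive_partial; last exact: smooth_differentiable.
apply: eq_bigr => i _; rewrite /partial.
have -> : (fun y => theta y (col_mx v w)) = \sum_j \sum_k
    ((v 0 j * w 0 k) *: comp2 theta j k).
  apply/funext => y; rewrite (form2_coordE (lt y)) fct_sumE.
  by apply: eq_bigr => j _; rewrite fct_sumE.
have db j k : derivable (comp2 theta j k) x (delta_mx 0 i).
  by apply: smooth_derivable; exact: st.
rewrite derive_sum; last by move=> j; apply: derivable_sum => k; apply: derivableZ; exact: db.
rewrite big_distrr /=; apply: eq_bigr => j _.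
rewrite derive_sum; last by move=> k; apply: derivableZ; exact: db.
rewrite big_distrr /=; apply: eq_bigr => k _.
by rewrite deriveZ // /GRing.scale /= !mulrA.
Qed.

(** Both sides of the coordinate formula for d theta are trilinear in the rows of v, so
    that closedness may be tested on coordinate vectors. *)
Lemma closed_form2P {R : realType} {m : nat} (theta : dform R m 2) :
  smooth_form theta ->
  (forall x i j k, partial i (comp2 theta j k) x - partial j (comp2 theta i k) x
    + partial k (comp2 theta i j) x = 0) ->
  closed_form theta.
Proof.
move=> st cl x v; rewrite ext_d2E !(derive_form2_coordE _ _ _ _ st).
move: (row 0 v) (row 1 v) (row 2%:R v) => {}v u w.
pose b i j k := partial i (comp2 theta j k) x.
have clb i j k : b i j k - b j i k + b k i j = 0 by exact: cl.
rewrite [X in _ - X + _](_ : _ = \sum_i \sum_j \sum_k v 0 i * u 0 j * w 0 k * b j i k).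
  rewrite [X in _ + X](_ : _ = \sum_i \sum_j \sum_k v 0 i * u 0 j * w 0 k * b k i j).
    rewrite -sumrB -big_split big1 //= => i _.
    rewrite -sumrB -big_split big1 //= => j _.
    rewrite -sumrB -big_split big1 //= => k _.
    by rewrite -/(b i j k) -mulrBr -mulrDr clb mulr0.
  rewrite exchange_big; apply: eq_bigr => i _ /=; rewrite exchange_big.
  by apply: eq_bigr => j _; apply: eq_bigr => k _; rewrite -/(b k i j); ring.
rewrite exchange_big; apply: eq_bigr => i _; apply: eq_bigr => j _.
by apply: eq_bigr => k _; rewrite -/(b j i k); ring.
Qed.

Lemma smooth_formD {R : realType} {m : nat} (theta eta : dform R m 2)
    (f : 'rV[R]_m -> R) :
  smooth_form theta -> smooth f -> smooth_form eta ->
  smooth_form (fun x v => theta x v + f x * eta x v).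
Proof.
move=> [lt at_ st] sf [le ae se]; split=> [x A B C i b c rA rB rC|x A i j ij rA|v].
- by rewrite (lt x _ _ _ _ _ _ rA rB rC) (le x _ _ _ _ _ _ rA rB rC); ring.
- by rewrite (at_ x A i j) // (ae x A i j) // mulr0 addr0.
- by apply: smoothD; [exact: st|apply: smoothM => //; exact: se].
Qed.

(** * The canonical symplectic form *)

Lemma canonical_formE {R : realType} {n : nat} x (u v : 'rV[R]_(n + n)) :
  canonical_form R n x (col_mx u v) = \sum_(j < n)
    (u 0 (lshift n j) * v 0 (rshift n j) - v 0 (lshift n j) * u 0 (rshift n j)).
Proof.
have E0 k : (col_mx u v : 'M[R]_(2, n + n)) 0 k = u 0 k.
  by have /rowP/(_ k) := row0_col_mx u v; rewrite mxE.
have E1 k : (col_mx u v : 'M[R]_(2, n + n)) 1 k = v 0 k.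
  by have /rowP/(_ k) := row1_col_mx u v; rewrite mxE.
by apply: eq_bigr => j _; rewrite !E0 !E1.
Qed.

Lemma smooth_canonical_form {R : realType} {n : nat} : smooth_form (canonical_form R n).
Proof.
split=> [x A B C i0 b c rA rB rC|x A i1 i2 i12 rA|v]; last exact: smooth_cst.
- rewrite /canonical_form !big_distrr -big_split; apply: eq_bigr => j _ /=.
  have rAj k : A i0 k = b * B i0 k + c * C i0 k.
    by move/rowP: rA => /(_ k); rewrite !mxE.
  case: (unliftP 0 i0) rAj rB rC => [i|] ->.
    rewrite ord1 (_ : lift 0 0 = 1); last exact: val_inj.
    move=> rAj; rewrite !row'1_mx => /rowP rB /rowP rC.
    have B0 k : B 0 k = A 0 k by have := rB k; rewrite !mxE.
    have C0 k : C 0 k = A 0 k by have := rC k; rewrite !mxE.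
    by rewrite !rAj !B0 !C0; ring.
  move=> rAj; rewrite !row'0_mx => /rowP rB /rowP rC.
  have B1 k : B 1 k = A 1 k by have := rB k; rewrite !mxE.
  have C1 k : C 1 k = A 1 k by have := rC k; rewrite !mxE.
  by rewrite !rAj !B1 !C1; ring.
- have r01 : row 0 A = row 1 A.
    case: (unliftP 0 i1) i12 rA => [k|] ->; case: (unliftP 0 i2) => [l|] -> //;
      by rewrite ?ord1 (_ : lift 0 0 = 1) //; exact: val_inj.
  have A01 k : A 0 k = A 1 k by move/rowP: r01 => /(_ k); rewrite !mxE.
  by rewrite /canonical_form big1 // => j _; rewrite !A01 mulrC subrr.
Qed.

Lemma closed_canonical_form {R : realType} {n : nat} : closed_form (canonical_form R n).
Proof.
move=> x v; rewrite /ext_d big1 // => i _.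
by rewrite (derive_cst (canonical_form R n x (row' i v))) mulr0.
Qed.

Lemma canonical_form_q {R : realType} {n : nat} x (u : 'rV[R]_(n + n)) (j : 'I_n) :
  canonical_form R n x (col_mx u (delta_mx 0 (lshift n j))) = - u 0 (rshift n j).
Proof.
rewrite canonical_formE (bigD1 j) //= big1 ?addr0.
  by rewrite !mxE !eqxx eq_rlshift mulr0 mul1r sub0r.
move=> i ij; rewrite !mxE eq_rlshift (inj_eq (@lshift_inj _ _)) (negbTE ij) /=.
by rewrite mulr0 mul0r subrr.
Qed.

Lemma canonical_form_p {R : realType} {n : nat} x (u : 'rV[R]_(n + n)) (j : 'I_n) :
  canonical_form R n x (col_mx u (delta_mx 0 (rshift n j))) = u 0 (lshift n j).
Proof.
rewrite canonical_formE (bigD1 j) //= big1 ?addr0.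
  by rewrite !mxE !eqxx eq_lrshift mulr1 mul0r subr0.
move=> i ij; rewrite !mxE eq_lrshift (inj_eq (@rshift_inj _ _)) (negbTE ij) /=.
by rewrite mulr0 mul0r subrr.
Qed.

Lemma nondegenerate_canonical_form {R : realType} {n : nat} :
  nondegenerate_form (canonical_form R n).
Proof.
move=> x X X0; apply/rowP => k; rewrite mxE.
case: (split_ordP k) => j ->.
  by rewrite -(canonical_form_p x).
by apply/eqP; rewrite -oppr_eq0 -(canonical_form_q x) X0.
Qed.

Lemma symplectic_canonical_form {R : realType} {n : nat} :
  symplectic_form (canonical_form R n).
Proof.
by split; [exact: smooth_canonical_form|exact: closed_canonical_form
  |exact: nondegenerate_canonical_form].
Qed.

(** * Divergent type implies closed up to a multiple of the symplectic form *)

Lemma alternating3_eq0 {R : realType} {n : nat} (T : 'I_n -> 'I_n -> 'I_n -> R) :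
  (forall i j k, T i j k = - T j i k) -> (forall i j k, T i j k = - T i k j) ->
  (forall i j k : 'I_n, (i < j)%N -> (j < k)%N -> T i j k = 0) ->
  forall i j k, T i j k = 0.
Proof.
move=> T12 T23 T0.
have Tii i k : T i i k = 0 by have := T12 i i k; lra.
have Tjj i j : T i j j = 0 by have := T23 i j j; lra.
have Tiji i j : T i j i = 0 by rewrite T23 Tii oppr0.
have Tlt (i j k : 'I_n) : (i < j)%N -> T i j k = 0.
  move=> ij; have [jk|kj|/val_inj <-] := ltngtP j k; [exact: T0| |exact: Tjj].
  have [ik|ki|/val_inj <-] := ltngtP i k; last exact: Tiji.
    by rewrite T23 T0 ?oppr0.
  by rewrite T23 T12 opprK T0.
move=> i j k; have [ij|ji|/val_inj <-] := ltngtP i j; [exact: Tlt| |exact: Tii].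
by rewrite T12 Tlt ?oppr0.
Qed.

Lemma ext_d1E {R : realType} {m : nat} (theta : dform R m 1) x (u v : 'rV[R]_m) :
  ext_d theta x (col_mx u v) = 'D_u (theta^~ v) x - 'D_v (theta^~ u) x.
Proof.
rewrite /ext_d !big_ord_recl big_ord0 addr0 expr0 mul1r.
rewrite (_ : lift ord0 ord0 = 1); last exact: val_inj.
rewrite expr1 mulN1r row0_col_mx row1_col_mx row'0_mx row'1_mx.
by rewrite row0_col_mx row1_col_mx.
Qed.

(** The Lefschetz isomorphism in dimension 4, with explicit inverse: a is the contraction
    of the 3-form c by the bivector dual to Omega, and the right-hand side is a /\ Omega.
    Both sides being alternating, four triples of coordinates have to be compared. *)
Lemma lefschetz_dim4 {R : realType} (c : 'I_(2 + 2) -> 'I_(2 + 2) -> 'I_(2 + 2) -> R)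
    (W := fun i j => comp2 (canonical_form R 2) i j 0)
    (a := fun i => \sum_(l < 2) c (lshift 2 l) (rshift 2 l) i) :
  (forall i j k, c i j k = - c j i k) -> (forall i j k, c i j k = - c i k j) ->
  forall i j k, c i j k = a i * W j k - a j * W i k + a k * W i j.
Proof.
move=> c12 c23 i j k; apply/eqP; rewrite -subr_eq0; apply/eqP.
have W_anti i1 j1 : W i1 j1 = - W j1 i1.
  by apply: form2_anti; case: (@smooth_canonical_form R 2).
have cii i1 k1 : c i1 i1 k1 = 0 by have := c12 i1 i1 k1; lra.
have cjj i1 k1 : c k1 i1 i1 = 0 by have := c23 k1 i1 i1; lra.
have ciji i1 k1 : c i1 k1 i1 = 0 by rewrite c23 cii oppr0.
have Wq i1 l : W i1 (lshift 2 l) = - (i1 == rshift 2 l)%:R.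
  by rewrite /W /comp2 canonical_form_q mxE eqxx eq_sym.
have Wp i1 l : W i1 (rshift 2 l) = (i1 == lshift 2 l)%:R.
  by rewrite /W /comp2 canonical_form_p mxE eqxx eq_sym.
pose q0 : 'I_(2 + 2) := lshift 2 0; pose q1 : 'I_(2 + 2) := lshift 2 1.
pose p0 : 'I_(2 + 2) := rshift 2 0; pose p1 : 'I_(2 + 2) := rshift 2 1.
have ord4 (i1 : 'I_(2 + 2)) : [\/ i1 = q0, i1 = q1, i1 = p0 | i1 = p1].
  by case: i1 => [[|[|[|[|//]]]] ?];
    [constructor 1|constructor 2|constructor 3|constructor 4]; exact: val_inj.
have aE i1 : a i1 = c q0 p0 i1 + c q1 p1 i1.
  rewrite /a !big_ord_recl big_ord0 addr0.
  by rewrite (_ : lift ord0 ord0 = 1) //; exact: val_inj.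
move: i j k; apply: alternating3_eq0.
- by move=> i j k; rewrite c12 (W_anti i j); ring.
- by move=> i j k; rewrite c23 (W_anti j k); ring.
move=> i j k; case: (ord4 i) => ->; case: (ord4 j) => -> //; case: (ord4 k) => -> // _ _.
all: rewrite !aE !(Wq, Wp) /= !(ciji, cjj).
all: have e1 := c23 q0 p0 q1; have e2 := c23 q1 p1 q0; have e3 := c12 q1 q0 p1.
all: have e4 := c23 q1 p1 p0; lra.
Qed.

Lemma smooth_comp2 {R : realType} {m : nat} (theta : dform R m 2) i j :
  smooth_form theta -> smooth (comp2 theta i j).
Proof. by case=> _ _ st; exact: st. Qed.

Lemma comp2_anti {R : realType} {m : nat} (theta : dform R m 2) i j :
  smooth_form theta -> comp2 theta i j = - comp2 theta j i.
Proof. by case=> lt at_ _; apply/funext => x; exact: form2_anti. Qed.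

(** Writing d omega = alpha /\ Omega with alpha = bot (d omega), closedness of alpha
    is the divergent type hypothesis, and d (omega + mu Omega) = (alpha + d mu) /\ Omega
    vanishes when mu is a potential of - alpha. *)
Lemma divergent_type_closed {R : realType} (omega : dform R (2 + 2) 2) :
  smooth_form omega -> divergent_type omega ->
  exists2 mu : 'rV[R]_(2 + 2) -> R, smooth mu &
    closed_form (fun x v => omega x v + mu x * canonical_form R 2 x v).
Proof.
move=> so div.
pose c i j k x := partial i (comp2 omega j k) x - partial j (comp2 omega i k) x
  + partial k (comp2 omega i j) x.
pose alpha i x := \sum_(l < 2) c (lshift 2 l) (rshift 2 l) i x.
have sb i j k : smooth (partial i (comp2 omega j k)).
  by apply: smooth_partial; exact: smooth_comp2.
have sc i j k : smooth (c i j k) by apply: smoothD; first exact: smoothB.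
have salpha i : smooth (alpha i) by exact: smooth_sum.
have botE i : (fun y => bot (ext_d omega) y (delta_mx 0 i)) = alpha i.
  by apply/funext => y; apply: eq_bigr => l _; exact: ext_d2_col_mx.
have pN i j k x : partial i (comp2 omega j k) x = - partial i (comp2 omega k j) x.
  rewrite (comp2_anti _ _ so) /partial deriveN //.
  by apply: smooth_derivable; exact: smooth_comp2.
have closed_alpha i j x : partial i (alpha j) x = partial j (alpha i) x.
  apply/eqP; rewrite -subr_eq0; apply/eqP.
  rewrite /partial -(botE i) -(botE j) -ext_d1E; exact: div.
have [||mu smu pmu] := poincare_lemma (alpha := fun i x => - alpha i x).
- by move=> j; exact: smoothN.
- have dN k l x : partial l (fun x => - alpha k x) x = - partial l (alpha k) x.
    by rewrite /partial (deriveN (f := alpha k)) //; exact: smooth_derivable.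
  by move=> i j x; rewrite (dN j i) (dN i j) closed_alpha.
exists mu => //; apply: closed_form2P.
  by apply: smooth_formD => //; exact: smooth_canonical_form.
move=> x i j k.
have p' l r s : partial l (comp2
      (fun x v => omega x v + mu x * canonical_form R 2 x v) r s) x =
    partial l (comp2 omega r s) x - alpha l x * comp2 (canonical_form R 2) r s 0.
  have -> : comp2 (fun x v => omega x v + mu x * canonical_form R 2 x v) r s =
      comp2 omega r s + comp2 (canonical_form R 2) r s 0 *: mu.
    by apply/funext => y; rewrite /comp2 mulrC.
  rewrite /partial deriveD; last 2 first.
  - by apply: smooth_derivable; exact: smooth_comp2.
  - by apply: derivableZ; exact: smooth_derivable.
  rewrite deriveZ; last exact: smooth_derivable.
  by rewrite -[X in _ *: X]/(partial l mu x) pmu -mulNr mulrC.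
have c12 i1 j1 k1 : c i1 j1 k1 x = - c j1 i1 k1 x.
  rewrite /c (pN k1 j1 i1).
  by move: (partial i1 _ x) (partial j1 _ x) (partial k1 _ x) => r s t; ring.
have c23 i1 j1 k1 : c i1 j1 k1 x = - c i1 k1 j1 x.
  rewrite /c (pN i1 k1 j1).
  by move: (partial i1 _ x) (partial j1 _ x) (partial k1 _ x) => r s t; ring.
have : c i j k x = alpha i x * comp2 (canonical_form R 2) j k 0
    - alpha j x * comp2 (canonical_form R 2) i k 0
    + alpha k x * comp2 (canonical_form R 2) i j 0.
  exact: (@lefschetz_dim4 R (fun i j k => c i j k x) c12 c23 i j k).
rewrite !p' /c; move: (partial i _ x) (partial j _ x) (partial k _ x) => r s t.
move: (comp2 _ j k 0) (comp2 _ i k 0) (comp2 _ i j 0) => w1 w2 w3.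
move: (alpha i x) (alpha j x) (alpha k x) => a1 a2 a3 E.
rewrite [LHS](_ : _ = r - s + t - (a1 * w1 - a2 * w2 + a3 * w3)); last by ring.
by rewrite E subrr.
Qed.

(** * Invariance of the Monge-Ampere operator *)

(** Along the section df one has dp_j = sum_k f_jk dq_k, and the symmetry of the Hessian
    makes the sum of the dq_j /\ dp_j vanish. *)
Lemma pullback_canonical_form {R : realType} {n : nat} (f : 'rV[R]_n -> R) x
    (v : 'M[R]_(2, n)) :
  smooth f -> pullback (df_section f) (canonical_form R n) x v = 0.
Proof.
move=> sf.
have sdf : smooth_field (df_section f).
  move=> k; case: (split_ordP k) => j ->.
    have -> : (fun y => df_section f y 0 (lshift n j)) = (fun y => y 0 j).
      by apply/funext => y; rewrite row_mxEl.
    exact: smooth_coord.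
  have -> : (fun y => df_section f y 0 (rshift n j)) = partial j f.
    by apply/funext => y; rewrite row_mxEr mxE.
  exact: smooth_partial.
have Jac r k : (v *m 'J (df_section f) x) r k =
    'D_(row r v) (fun y => df_section f y 0 k) x.
  rewrite -derive_field // deriveEjacobian; last exact: smooth_field_differentiable.
  by rewrite -row_mul [RHS]mxE.
have Jq r j : (v *m 'J (df_section f) x) r (lshift n j) = v r j.
  rewrite Jac.
  have -> : (fun y => df_section f y 0 (lshift n j)) = (fun y => y 0 j).
    by apply/funext => y; rewrite row_mxEl.
  by rewrite derive_coord mxE.
have Jp r j : (v *m 'J (df_section f) x) r (rshift n j) =
    \sum_k v r k * partial k (partial j f) x.
  rewrite Jac.
  have -> : (fun y => df_section f y 0 (rshift n j)) = partial j f.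
    by apply/funext => y; rewrite row_mxEr mxE.
  rewrite derive_partial; last by apply: smooth_differentiable; exact: smooth_partial.
  by apply: eq_bigr => k _; rewrite mxE.
rewrite /pullback /canonical_form.
under eq_bigr do rewrite !Jq !Jp; rewrite sumrB.
apply/eqP; rewrite subr_eq0; apply/eqP.
under eq_bigr do rewrite big_distrr /=; under [RHS]eq_bigr do rewrite big_distrr /=.
rewrite exchange_big; apply: eq_bigr => k _; apply: eq_bigr => j _.
by rewrite mulrCA /partial derive_sym.
Qed.

(** * The Courant bracket on graphs of closed two-forms *)

Lemma linfunE {R : realType} {U V : vectType R} (f : U -> V) :
  linear f -> linfun f =1 f.
Proof.
move=> lf; pose L : {linear U -> V} := HB.pack f (GRing.isLinear.Build _ _ _ _ _ lf).
exact: (lfunE L).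
Qed.

Definition smooth_covector_field {R : realType} {m : nat} (eta : 'rV[R]_m -> dual R m) :=
  forall v, smooth (fun x => (eta x v : R)).

Lemma smooth_covector_apply {R : realType} {m : nat} (eta : 'rV[R]_m -> dual R m)
    (X : 'rV[R]_m -> 'rV[R]_m) :
  smooth_covector_field eta -> smooth_field X -> smooth (fun x => (eta x (X x) : R)).
Proof.
move=> se sX.
have -> : (fun x => eta x (X x) : R) =
    (fun x => \sum_j X x 0 j * (eta x (delta_mx 0 j) : R)).
  apply/funext => x; rewrite [X x in LHS]row_sum_delta linear_sum.
  by apply: eq_bigr => j _; rewrite linearZ.
by apply: smooth_sum => j; apply: smoothM; [exact: sX|exact: se].
Qed.

Lemma smooth_const_field {R : realType} {m n : nat} (v : 'rV[R]_n) :
  smooth_field (fun _ : 'rV[R]_m => v).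
Proof. by move=> j; exact: smooth_cst. Qed.

Lemma smooth_derive_field {R : realType} {m n : nat} (X : 'rV[R]_m -> 'rV[R]_m)
    (Y : 'rV[R]_m -> 'rV[R]_n) :
  smooth_field X -> smooth_field Y -> smooth_field (fun x => 'D_(X x) Y x).
Proof.
move=> sX sY j.
have -> : (fun x => ('D_(X x) Y x) 0 j) = (fun x => 'D_(X x) (fun y => Y y 0 j) x).
  by apply/funext => x; rewrite derive_field.
exact: smooth_derive.
Qed.

Lemma derive_linear {R : realType} {V W : normedModType R} (f : V -> W) (x : V) :
  differentiable f x -> linear (fun v => 'D_v f x).
Proof. by move=> df a u v; rewrite !deriveE // linearP. Qed.

Lemma derive_covector_linear {R : realType} {m : nat} (eta : 'rV[R]_m -> dual R m)
    (x v : 'rV[R]_m) :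
  smooth_covector_field eta -> linear (fun V => 'D_v (fun y => eta y V : R) x : R^o).
Proof.
move=> se a U W.
have dU V : derivable (fun y => eta y V : R) x v by apply: smooth_derivable; exact: se.
have -> : (fun y => eta y (a *: U + W) : R) =
    a *: (fun y => eta y U : R) + (fun y => eta y W : R).
  by apply/funext => y; rewrite linearP.
by rewrite deriveD ?deriveZ //; exact: derivableZ.
Qed.

Lemma linear_sub {R : pzRingType} {U V : lmodType R} (f g : U -> V) :
  linear f -> linear g -> linear (fun v => f v - g v).
Proof. by move=> lf lg a u v; rewrite lf lg scalerBr opprD addrACA. Qed.

Lemma lie_derivE {R : realType} {m : nat} (X : 'rV[R]_m -> 'rV[R]_m)
    (eta : 'rV[R]_m -> dual R m) (x V : 'rV[R]_m) :
  smooth_field X -> smooth_covector_field eta ->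
  lie_deriv X eta x V = 'D_(X x) (fun y => eta y V : R) x + eta x ('D_V X x) :> R.
Proof.
move=> sX se.
have E W : eta x (lie_bracket X (fun=> W) x) = - eta x ('D_W X x).
  by rewrite /lie_bracket derive_cst sub0r linearN.
rewrite /lie_deriv linfunE ?E ?opprK //.
apply: linear_sub; first exact: derive_covector_linear.
under [X in linear X]eq_fun do rewrite E.
have lX := derive_linear (smooth_field_differentiable x sX).
by move=> a U W; rewrite lX linearP opprD scalerN.
Qed.

Lemma dfunE {R : realType} {m : nat} (g : 'rV[R]_m -> R) (x V : 'rV[R]_m) :
  differentiable g x -> dfun g x V = 'D_V g x :> R.
Proof.
move=> dg; rewrite /dfun deriveE // linfunE // => a u v.
exact: linearP.
Qed.

(** Half of the covector part of the Courant bracket: the full one is obtained by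
    antisymmetrization in (X, xi) and (Y, eta). *)
Definition half_bracket {R : realType} {m : nat} (X : 'rV[R]_m -> 'rV[R]_m)
    (eta : 'rV[R]_m -> 'rV[R]_m -> R) (x V : 'rV[R]_m) : R :=
  'D_(X x) (eta^~ V) x + eta x ('D_V X x) - 2^-1 * 'D_V (fun y => eta y (X y)) x.

Lemma courant_covectorE {R : realType} {m : nat} (e f : 'rV[R]_m -> TT R m)
    (x V : 'rV[R]_m) :
  smooth_section e -> smooth_section f ->
  (courant e f x).2 V =
    half_bracket (fun y => (e y).1) (fun y v => (f y).2 v) x V
    - half_bracket (fun y => (f y).1) (fun y v => (e y).2 v) x V :> R.
Proof.
move=> [sX sxi] [sY seta].
have s1 := smooth_covector_apply seta sX; have s2 := smooth_covector_apply sxi sY.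
pose g y : R := (f y).2 (e y).1; pose h y : R := (e y).2 (f y).1.
have dgh : dfun (fun y => g y - h y) x V = 'D_V g x - 'D_V h x :> R.
  rewrite dfunE; first by apply: deriveB; exact: smooth_derivable.
  by apply: smooth_differentiable; exact: smoothB.
pose X y := (e y).1; pose xi y := (e y).2; pose Y y := (f y).1; pose eta y := (f y).2.
have -> : (courant e f x).2 V = lie_deriv X eta x V - lie_deriv Y xi x V
    - 2^-1 * (dfun (fun y => g y - h y) x V : R) :> R.
  by rewrite /courant /= !(add_lfunE, opp_lfunE) scale_lfunE.
have E1 := lie_derivE x V sX seta; have E2 := lie_derivE x V sY sxi.
rewrite (congr2 (fun a b : R => a - b) (congr2 (fun a b : R => a - b) E1 E2)
  (congr1 (fun c : R => 2^-1 * c) dgh)) /half_bracket.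
move: ('D_(X x) (fun y => eta y V : R) x) ('D_(Y x) (fun y => xi y V : R) x).
move: ('D_V g x) ('D_V h x) (eta x ('D_V X x)) (xi x ('D_V Y x)) => a b c d p q.
by ring.
Qed.

(** By the Leibniz rule, the terms with derivatives of X and Y along V cancel in the
    antisymmetrization.  What remains is B ([X, Y], V) and the derivatives of B, which
    add up to (d B) (X, Y, V). *)
Lemma half_bracket_closed {R : realType} {m : nat} (B : dform R m 2)
    (X Y : 'rV[R]_m -> 'rV[R]_m) (x V : 'rV[R]_m) :
  smooth_form B -> closed_form B -> smooth_field X -> smooth_field Y ->
  half_bracket X (fun y v => B y (col_mx (Y y) v)) x V
    - half_bracket Y (fun y v => B y (col_mx (X y) v)) x V =
  B x (col_mx (lie_bracket X Y x) V).
Proof.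
have arith (p q r a b s s' t t' : R) : p - q + r = 0 -> s' = - s -> t' = - t ->
    p + a + t - 2^-1 * (- r + (s' + t)) - (q + b + s - 2^-1 * (r + (t' + s))) = a - b.
  by move=> pqr -> ->; lra.
move=> sB cB sX sY; have [lB aB _] := sB.
have sV := @smooth_const_field R m m V.
have dB := cB x (col_mx (X x) (col_mx (Y x) V)).
rewrite ext_d2_col_mx in dB.
have E1 := derive_form2 x (X x) sB sY sV.
have E2 := derive_form2 x (Y x) sB sX sV.
have E3 := derive_form2 x V sB sY sX.
have E4 := derive_form2 x V sB sX sY.
have E5 : 'D_V (fun y => B y (col_mx (Y x) (X x))) x = - 'D_V (fun y => B y (col_mx (X x) (Y x))) x.
  have -> : (fun y => B y (col_mx (Y x) (X x))) = - (fun y => B y (col_mx (X x) (Y x))).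
    by apply/funext => y; exact: form2_anti.
  by apply: deriveN; apply: smooth_derivable; case: sB.
rewrite !derive_cst !(form20r (lB x)) !addr0 in E1 E2.
rewrite /half_bracket E1 E2 E3 E4 E5 /lie_bracket (form2Bl (lB x)).
have A1 := form2_anti (lB x) (aB x) ('D_V Y x) (X x).
have A2 := form2_anti (lB x) (aB x) ('D_V X x) (Y x).
exact: (arith _ _ _ _ _ _ _ _ _ dB A1 A2).
Qed.

Lemma half_bracket_comb {R : realType} {m : nat} (X : 'rV[R]_m -> 'rV[R]_m)
    (eta eta1 eta2 : 'rV[R]_m -> 'rV[R]_m -> R) (s : R) (x V : 'rV[R]_m) :
  smooth_field X ->
  (forall W, smooth_field W -> smooth (fun y => eta1 y (W y))) ->
  (forall W, smooth_field W -> smooth (fun y => eta2 y (W y))) ->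
  (forall y W, eta y W = eta1 y W + s * eta2 y W) ->
  half_bracket X eta x V = half_bracket X eta1 x V + s * half_bracket X eta2 x V.
Proof.
move=> sX s1 s2 E; rewrite /half_bracket.
have D (W : 'rV[R]_m -> 'rV[R]_m) w : smooth_field W ->
    'D_w (fun y => eta y (W y)) x =
    'D_w (fun y => eta1 y (W y)) x + s * 'D_w (fun y => eta2 y (W y)) x.
  move=> sW.
  have -> : (fun y => eta y (W y)) =
      (fun y => eta1 y (W y)) + s *: (fun y => eta2 y (W y)).
    by apply/funext => y; exact: E.
  have d1 : derivable (fun y => eta1 y (W y)) x w by apply: smooth_derivable; exact: s1.
  have d2 : derivable (fun y => eta2 y (W y)) x w by apply: smooth_derivable; exact: s2.
  have d3 : derivable (s *: (fun y => eta2 y (W y))) x w by exact: derivableZ.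
  exact: etrans (deriveD d1 d3) (congr1 _ (deriveZ s d2)).
rewrite (D (fun=> V) _ (smooth_const_field V)) (D X _ sX) E.
move: ('D_V _ x) ('D_V (fun y => eta2 y (X y)) x) => p q.
move: ('D_(X x) _ x) ('D_(X x) (eta2^~ V) x) => a b.
by move: (eta1 x _) (eta2 x _) => c d; ring.
Qed.

Lemma smooth_half_bracket {R : realType} {m : nat} (X : 'rV[R]_m -> 'rV[R]_m)
    (eta : 'rV[R]_m -> dual R m) (V : 'rV[R]_m) :
  smooth_field X -> smooth_covector_field eta ->
  smooth (half_bracket X (fun y v => eta y v)^~ V).
Proof.
move=> sX se; have sV := @smooth_const_field R m m V.
apply: smoothB; last apply: smoothZ.
- apply: smoothD; first exact: (smooth_derive (se V) sX).
  by apply: smooth_covector_apply => //; exact: smooth_derive_field.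
- by apply: (smooth_derive _ sV); exact: smooth_covector_apply.
Qed.

Lemma smooth_courant {R : realType} {m : nat} (e f : 'rV[R]_m -> TT R m) :
  smooth_section e -> smooth_section f -> smooth_section (courant e f).
Proof.
move=> se sf; have [sX sxi] := se; have [sY seta] := sf; split=> [j|V].
  have -> : (fun x => (courant e f x).1 0 j) = (fun x =>
      ('D_((e x).1) (fun y => (f y).1) x) 0 j - ('D_((f x).1) (fun y => (e y).1) x) 0 j).
    by apply/funext => x; rewrite !mxE.
  apply: smoothB; last exact: (smooth_derive_field sY sX).
  exact: (smooth_derive_field sX sY).
have -> : (fun x => (courant e f x).2 V : R) = (fun x =>
    half_bracket (fun y => (e y).1) (fun y v => (f y).2 v) x V
    - half_bracket (fun y => (f y).1) (fun y v => (e y).2 v) x V).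
  by apply/funext => x; exact: courant_covectorE.
by apply: smoothB; exact: smooth_half_bracket.
Qed.

Lemma smooth_sectionD {R : realType} {m : nat} (e f : 'rV[R]_m -> TT R m) :
  smooth_section e -> smooth_section f -> smooth_section (fun x => e x + f x).
Proof.
move=> [e1 e2] [f1 f2]; split=> [j|V].
  have -> : (fun x => (e x + f x).1 0 j) = (fun x => (e x).1 0 j + (f x).1 0 j).
    by apply/funext => x; rewrite mxE.
  exact: smoothD.
have -> : (fun x => (e x + f x).2 V : R) = (fun x => (e x).2 V + (f x).2 V : R).
  by apply/funext => x; rewrite add_lfunE.
exact: smoothD.
Qed.

Lemma smooth_sectionN {R : realType} {m : nat} (e : 'rV[R]_m -> TT R m) :
  smooth_section e -> smooth_section (fun x => - e x).
Proof.
move=> [e1 e2]; split=> [j|V].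
  have -> : (fun x => (- e x).1 0 j) = (fun x => - (e x).1 0 j).
    by apply/funext => x; rewrite mxE.
  exact: smoothN.
have -> : (fun x => (- e x).2 V : R) = (fun x => - (e x).2 V : R).
  by apply/funext => x; rewrite opp_lfunE.
exact: smoothN.
Qed.

Lemma smooth_courantC {R : realType} {m : nat} (e f : 'rV[R]_m -> TTC R m) :
  smooth_csection e -> smooth_csection f -> smooth_csection (courantC e f).
Proof.
move=> [er ei] [fr fi]; split.
- apply: smooth_sectionD; first exact: smooth_courant.
  by apply: smooth_sectionN; exact: smooth_courant.
- by apply: smooth_sectionD; exact: smooth_courant.
Qed.

(** The graph of the complex two-form B1 + i B2, in real and imaginary parts.  The
    factors -1 and 1 give the two equations the shape required by half_bracket_comb. *)
Definition graph_form {R : realType} {m : nat} (B1 B2 : dform R m 2)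
    (x : 'rV[R]_m) (e : TTC R m) : Prop :=
  forall V : 'rV[R]_m,
    ((complex.Re e).2 V : R) = B1 x (col_mx (complex.Re e).1 V)
      + -1 * B2 x (col_mx (complex.Im e).1 V) /\
    ((complex.Im e).2 V : R) = B2 x (col_mx (complex.Re e).1 V)
      + 1 * B1 x (col_mx (complex.Im e).1 V).

(** Expanding both covector parts by bilinearity, each of the four products of real and
    imaginary parts is an antisymmetrized half bracket of one closed real form, to which
    half_bracket_closed applies. *)
Lemma courant_closed_graph_form {R : realType} {m : nat} (B1 B2 : dform R m 2) :
  smooth_form B1 -> closed_form B1 -> smooth_form B2 -> closed_form B2 ->
  courant_closed (graph_form B1 B2).
Proof.
have arith_re (a a' b b' c c' d d' p q r s : R) :
    a - a' = p -> b - b' = q -> c - c' = r -> d - d' = s ->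
    a + -1 * c - (a' + -1 * d') - (d + 1 * b - (c' + 1 * b')) = p - q + -1 * (r + s).
  by move=> <- <- <- <-; ring.
have arith_im (a a' b b' c c' d d' p q r s : R) :
    a - a' = p -> b - b' = q -> c - c' = r -> d - d' = s ->
    a + 1 * c - (c' + -1 * b') + (d + -1 * b - (a' + 1 * d')) = p - q + 1 * (r + s).
  by move=> <- <- <- <-; ring.
move=> s1 c1 s2 c2 e f [se ge] [sf gf]; split; first exact: smooth_courantC.
have [ser sei] := se; have [sfr sfi] := sf.
pose X y := (complex.Re (e y)).1; pose X' y := (complex.Im (e y)).1.
pose Y y := (complex.Re (f y)).1; pose Y' y := (complex.Im (f y)).1.
have sX : smooth_field X by case: ser.
have sX' : smooth_field X' by case: sei.
have sY : smooth_field Y by case: sfr.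
have sY' : smooth_field Y' by case: sfi.
have smB (B : dform R m 2) (Z : 'rV[R]_m -> 'rV[R]_m) : smooth_form B -> smooth_field Z ->
    forall W, smooth_field W -> smooth (fun y => B y (col_mx (Z y) (W y))).
  by move=> [lB _ sB] sZ W sW; exact: smooth_form2.
move=> x V; have [l1 _ _] := s1; have [l2 _ _] := s2.
pose K (B : dform R m 2) (Z W : 'rV[R]_m -> 'rV[R]_m) :=
  half_bracket Z (fun y v => B y (col_mx (W y) v)) x V.
have KB (B : dform R m 2) Z W : smooth_form B -> closed_form B -> smooth_field Z ->
    smooth_field W -> K B Z W - K B W Z = B x (col_mx (lie_bracket Z W x) V).
  by move=> *; exact: half_bracket_closed.
(* the half brackets of a field Z with the two covector parts of a section g of the graph *)
have Hre (g : 'rV[R]_m -> TTC R m) Z : smooth_csection g ->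
    (forall y, graph_form B1 B2 y (g y)) -> smooth_field Z ->
    half_bracket Z (fun y v => (complex.Re (g y)).2 v) x V =
    K B1 Z (fun y => (complex.Re (g y)).1) + -1 * K B2 Z (fun y => (complex.Im (g y)).1).
  move=> [[gr _] [gi _]] gg sZ; apply: half_bracket_comb => //.
  - exact: smB.
  - exact: smB.
  - by move=> y W; have [] := gg y W.
have Him (g : 'rV[R]_m -> TTC R m) Z : smooth_csection g ->
    (forall y, graph_form B1 B2 y (g y)) -> smooth_field Z ->
    half_bracket Z (fun y v => (complex.Im (g y)).2 v) x V =
    K B2 Z (fun y => (complex.Re (g y)).1) + 1 * K B1 Z (fun y => (complex.Im (g y)).1).
  move=> [[gr _] [gi _]] gg sZ; apply: half_bracket_comb => //.
  - exact: smB.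
  - exact: smB.
  - by move=> y W; have [] := gg y W.
pose L Z W := lie_bracket Z W x.
have lre B : smooth_form B -> B x (col_mx (complex.Re (courantC e f x)).1 V) =
    B x (col_mx (L X Y) V) - B x (col_mx (L X' Y') V).
  by move=> [lB _ _]; exact: (form2Bl (lB x)).
have lim B : smooth_form B -> B x (col_mx (complex.Im (courantC e f x)).1 V) =
    B x (col_mx (L X Y') V) + B x (col_mx (L X' Y) V).
  by move=> [lB _ _]; exact: (form2Dl (lB x)).
split.
- have -> : (complex.Re (courantC e f x)).2 V =
      (courant (fun x => complex.Re (e x)) (fun x => complex.Re (f x)) x).2 V
      - (courant (fun x => complex.Im (e x)) (fun x => complex.Im (f x)) x).2 V :> R.
    by rewrite /courantC /= add_lfunE opp_lfunE.
  have E1 := etrans (courant_covectorE x V ser sfr)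
    (congr2 (fun a b : R => a - b) (Hre f X sf gf sX) (Hre e Y se ge sY)).
  have E2 := etrans (courant_covectorE x V sei sfi)
    (congr2 (fun a b : R => a - b) (Him f X' sf gf sX') (Him e Y' se ge sY')).
  apply: (etrans (congr2 (fun a b : R => a - b) E1 E2)).
  apply: (etrans _ (congr2 (fun a b : R => a + -1 * b) (esym (lre B1 s1)) (esym (lim B2 s2)))).
  have A := (arith_re _ _ _ _ _ _ _ _ _ _ _ _ (KB B1 X Y s1 c1 sX sY) (KB B1 X' Y' s1 c1 sX' sY')
    (KB B2 X Y' s2 c2 sX sY') (KB B2 X' Y s2 c2 sX' sY)).
  exact: A.
- have -> : (complex.Im (courantC e f x)).2 V =
      (courant (fun x => complex.Re (e x)) (fun x => complex.Im (f x)) x).2 V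
      + (courant (fun x => complex.Im (e x)) (fun x => complex.Re (f x)) x).2 V :> R.
    by rewrite /courantC /= add_lfunE.
  have E1 := etrans (courant_covectorE x V ser sfi)
    (congr2 (fun a b : R => a - b) (Him f X sf gf sX) (Hre e Y' se ge sY')).
  have E2 := etrans (courant_covectorE x V sei sfr)
    (congr2 (fun a b : R => a - b) (Hre f X' sf gf sX') (Him e Y se ge sY)).
  apply: (etrans (congr2 (fun a b : R => a + b) E1 E2)).
  apply: (etrans _ (congr2 (fun a b : R => a + 1 * b) (esym (lre B2 s2)) (esym (lim B1 s1)))).
  have A := (arith_im _ _ _ _ _ _ _ _ _ _ _ _ (KB B2 X Y s2 c2 sX sY) (KB B2 X' Y' s2 c2 sX' sY')
    (KB B1 X Y' s1 c1 sX sY') (KB B1 X' Y s1 c1 sX' sY)).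
  exact: A.
Qed.

(** * The generalized complex structure *)

Section SharpOperator.
Context {R : realType} {n : nat}.
Implicit Types (xi : dual R (n + n)) (X Y : 'rV[R]_(n + n)).
Local Notation Om x X Y := (canonical_form R n x (@col_mx R 1 1 (n + n) X Y)).

(** The inverse of X |-> iota_X Omega, in coordinates (q, p). *)
Definition sharp xi : 'rV[R]_(n + n) :=
  row_mx (\row_j (xi (pvec j) : R)) (\row_j (- xi (qvec j) : R)).

Lemma canonical_form_sharp x xi Y : Om x (sharp xi) Y = xi Y.
Proof.
have -> : xi Y = \sum_(k < n + n) Y 0 k * (xi (delta_mx 0 k) : R) :> R.
  rewrite [Y in LHS]row_sum_delta linear_sum.
  by apply: eq_bigr => k _; rewrite linearZ.
rewrite canonical_formE big_split_ord /=. rewrite -big_split /=; apply: eq_bigr => j _.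
rewrite /sharp row_mxEl row_mxEr !mxE /pvec /qvec; ring.
Qed.

Lemma canonical_form_inj x X X' :
  (forall Y, Om x X Y = Om x X' Y) -> X = X'.
Proof.
move=> XX'; apply/subr0_eq/(@nondegenerate_canonical_form R n x) => Y.
have [lO _ _] := @smooth_canonical_form R n.
by rewrite (form2Bl (lO x)) XX' subrr.
Qed.

End SharpOperator.

Lemma flatE {R : realType} {m : nat} (theta : dform R m 2) (x X Y : 'rV[R]_m) :
  (forall W, linear (fun U : 'rV[R]_m => theta x (@col_mx R 1 1 m U W) : R^o)) ->
  (forall U, linear (fun W : 'rV[R]_m => theta x (@col_mx R 1 1 m U W) : R^o)) ->
  flat theta x X Y = theta x (col_mx X Y) :> R.
Proof.
move=> lX lY; rewrite /flat linfunE; first by rewrite linfunE.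
by move=> a U W; apply/lfunP => Z; rewrite add_lfunE scale_lfunE !linfunE // lX.
Qed.

Lemma flat_formE {R : realType} {m : nat} (theta : dform R m 2) (x X Y : 'rV[R]_m) :
  multilinear_form (theta x) -> flat theta x X Y = theta x (col_mx X Y) :> R.
Proof.
by move=> lt; apply: flatE => [W|W] a u v; rewrite (form2_linearl lt, form2_linearr lt).
Qed.

Lemma flat_inv_sharp {R : realType} {n : nat} x (xi : dual R (n + n)) :
  ((flat (canonical_form R n) x)^-1)%VF xi = sharp xi.
Proof.
have [lO _ _] := @smooth_canonical_form R n.
have flat_sharp : flat (canonical_form R n) x (sharp xi) = xi.
  by apply/lfunP => Y; rewrite [LHS]flat_formE // canonical_form_sharp.
rewrite -[in LHS]flat_sharp lker0_lfunK //; apply/lker0P => X X' XX'.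
apply: (canonical_form_inj (x := x)) => Y.
by rewrite -!flat_formE // XX'.
Qed.

Lemma sharp_linear {R : realType} {n : nat} : linear (@sharp R n).
Proof.
move=> a xi eta; apply: (@canonical_form_inj R n 0) => Y.
have [lO _ _] := @smooth_canonical_form R n.
by rewrite (form2_linearl (lO 0)) !canonical_form_sharp add_lfunE scale_lfunE.
Qed.

Section HitchinStructure.
Context {R : realType} {n : nat}.
Variables (omega : dform R (n + n) 2) (A : 'rV[R]_(n + n) -> 'End('rV[R]_(n + n))).
Hypothesis omega_smooth : smooth_form omega.
Local Notation Om x X Y := (canonical_form R n x (@col_mx R 1 1 (n + n) X Y)).
Local Notation om x X Y := (omega x (@col_mx R 1 1 (n + n) X Y)).
Hypothesis AE : forall x X Y, Om x (A x X) Y = om x X Y.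
Let J := gcs_matrix (canonical_form R n) A.

Let lO x : multilinear_form (canonical_form R n x).
Proof. by case: (@smooth_canonical_form R n). Qed.
Let aO x : alternating_form (canonical_form R n x).
Proof. by case: (@smooth_canonical_form R n). Qed.
Let lo x : multilinear_form (omega x).
Proof. by case: omega_smooth. Qed.
Let ao x : alternating_form (omega x).
Proof. by case: omega_smooth. Qed.

Lemma hitchin_self_adjoint x X Y : Om x (A x X) Y = Om x X (A x Y).
Proof. by rewrite AE (form2_anti (lo x) (ao x)) -AE (form2_anti (lO x) (aO x)) opprK. Qed.

Lemma omega_tildeE x X Y :
  omega_tilde (canonical_form R n) A x (@col_mx R 1 1 (n + n) X Y)
  = - Om x (X + A x (A x X)) Y.
Proof.
rewrite /omega_tilde /twist row0_col_mx row1_col_mx.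
by rewrite add_lfunE id_lfunE comp_lfunE.
Qed.

Lemma flat_omega_tildeE x X Y :
  flat (omega_tilde (canonical_form R n) A) x X Y = - Om x (X + A x (A x X)) Y :> R.
Proof.
rewrite flatE ?omega_tildeE // => [W|W] a u v; rewrite !omega_tildeE.
  have -> : a *: u + v + A x (A x (a *: u + v)) =
      a *: (u + A x (A x u)) + (v + A x (A x v)).
    by rewrite !linearP scalerDr addrACA.
  by rewrite (form2_linearl (lO x)) opprD -mulrN.
by rewrite (form2_linearr (lO x)) opprD -mulrN.
Qed.

Lemma gcs_matrixE x (e : TT R (n + n)) :
  J x e = (A x e.1 + sharp e.2,
     flat (omega_tilde (canonical_form R n) A) x e.1 - (e.2 \o A x)%VF).
Proof.
rewrite /J /gcs_matrix linfunE ?flat_inv_sharp // => a u v.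
have E1 : A x (a *: u + v).1 + ((flat (canonical_form R n) x)^-1)%VF (a *: u + v).2 =
    a *: (A x u.1 + ((flat (canonical_form R n) x)^-1)%VF u.2)
      + (A x v.1 + ((flat (canonical_form R n) x)^-1)%VF v.2).
  by rewrite !linearP scalerDr addrACA.
have E2 : flat (omega_tilde (canonical_form R n) A) x (a *: u + v).1
      - ((a *: u + v).2 \o A x)%VF =
    a *: (flat (omega_tilde (canonical_form R n) A) x u.1 - (u.2 \o A x)%VF)
      + (flat (omega_tilde (canonical_form R n) A) x v.1 - (v.2 \o A x)%VF).
  by rewrite linearP /= comp_lfunDl -comp_lfunZl scalerBr opprD addrACA.
by rewrite E1 E2.
Qed.

(** Pairing the vector part with Omega eliminates sharp, so that equalities J e = f
    reduce to identities between numbers. *)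
Lemma gcs_matrixP x (e f : TT R (n + n)) :
  (forall Y, Om x (A x e.1) Y + e.2 Y = Om x f.1 Y :> R) ->
  (forall Y, - Om x (e.1 + A x (A x e.1)) Y - e.2 (A x Y) = f.2 Y :> R) ->
  J x e = f.
Proof.
move=> H1 H2; rewrite gcs_matrixE [RHS]surjective_pairing; congr (_, _).
  apply: (canonical_form_inj (x := x)) => Y.
  by rewrite (form2Dl (lO x)) canonical_form_sharp.
apply/lfunP => Y; rewrite add_lfunE opp_lfunE comp_lfunE -[RHS]H2.
by rewrite -[in RHS]flat_omega_tildeE.
Qed.

Lemma gcs_matrix1E x (e : TT R (n + n)) Y :
  Om x (J x e).1 Y = Om x (A x e.1) Y + e.2 Y :> R.
Proof. by rewrite gcs_matrixE /= (form2Dl (lO x)) canonical_form_sharp. Qed.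

Lemma gcs_matrix2E x (e : TT R (n + n)) Y :
  (J x e).2 Y = - Om x (e.1 + A x (A x e.1)) Y - e.2 (A x Y) :> R.
Proof.
by rewrite gcs_matrixE /= add_lfunE opp_lfunE comp_lfunE -flat_omega_tildeE.
Qed.

(** The entry omega_tilde = - Omega (1 + A^2) is dictated by this equation. *)
Lemma gcs_matrix_sqr x e : J x (J x e) = - e.
Proof.
have J1 Y : Om x (A x (J x e).1) Y = Om x (A x (A x e.1)) Y + e.2 (A x Y) :> R.
  by rewrite !hitchin_self_adjoint gcs_matrix1E !hitchin_self_adjoint.
apply: gcs_matrixP => Y.
  rewrite J1 gcs_matrix2E (form2Dl (lO x)) (form2Nl (lO x)); ring.
rewrite gcs_matrix2E (form2Dl (lO x)) hitchin_self_adjoint J1 gcs_matrix1E.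
rewrite (form2Dl (lO x)) -!hitchin_self_adjoint opp_lfunE; ring.
Qed.

Lemma gcs_matrix_anti x (e f : TT R (n + n)) :
  pairing (J x e) f = - pairing e (J x f).
Proof.
have sharpE (xi : dual R (n + n)) Y : xi Y = Om x (sharp xi) Y :> R.
  by rewrite canonical_form_sharp.
have E1 := sharpE e.2 (J x f).1; have E2 := sharpE f.2 (J x e).1.
rewrite /pairing !gcs_matrix2E.
have F1 : e.2 (J x f).1 = - (Om x (A x f.1) (sharp e.2) + f.2 (sharp e.2)) :> R.
  by rewrite sharpE (form2_anti (lO x) (aO x)) gcs_matrix1E.
have F2 : f.2 (J x e).1 = - (Om x (A x e.1) (sharp f.2) + e.2 (sharp f.2)) :> R.
  by rewrite sharpE (form2_anti (lO x) (aO x)) gcs_matrix1E.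
have G : f.2 (sharp e.2) = - e.2 (sharp f.2) :> R.
  by rewrite !sharpE (form2_anti (lO x) (aO x)).
have H1 : e.2 (A x f.1) = - Om x (A x f.1) (sharp e.2) :> R.
  by rewrite sharpE (form2_anti (lO x) (aO x)).
have H2 : f.2 (A x e.1) = - Om x (A x e.1) (sharp f.2) :> R.
  by rewrite sharpE (form2_anti (lO x) (aO x)).
have K : Om x (e.1 + A x (A x e.1)) f.1 = - Om x (f.1 + A x (A x f.1)) e.1.
  rewrite !(form2Dl (lO x)) !hitchin_self_adjoint (form2_anti (lO x) (aO x) f.1 e.1).
  rewrite (form2_anti (lO x) (aO x) f.1 (A x (A x e.1))) !hitchin_self_adjoint; ring.
rewrite F1 F2 G H1 H2 K; ring.
Qed.

End HitchinStructure.

Lemma smooth_formZ {R : realType} {m : nat} (c : R) (theta : dform R m 2) :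
  smooth_form theta -> smooth_form (fun x v => c * theta x v).
Proof.
move=> [lt at_ st]; split=> [x A B C i b d rA rB rC|x A i j ij rA|v].
- by rewrite (lt x _ _ _ _ _ _ rA rB rC); ring.
- by rewrite (at_ x A i j) // mulr0.
- by apply: smoothZ; exact: st.
Qed.

Lemma closed_formZ {R : realType} {m : nat} (c : R) (theta : dform R m 2) :
  smooth_form theta -> closed_form theta -> closed_form (fun x v => c * theta x v).
Proof.
move=> [_ _ st] ct x v; rewrite -(mulr0 c) -(ct x v) /ext_d big_distrr /=.
apply: eq_bigr => i _.
have dt : derivable (theta^~ (row' i v)) x (row i v) by apply: smooth_derivable; exact: st.
by rewrite (deriveZ c dt) mulrCA.
Qed.

Lemma smooth_field_canonical {R : realType} {n : nat}
    (Z : 'rV[R]_(n + n) -> 'rV[R]_(n + n)) :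
  (forall V, smooth (fun x => canonical_form R n x (@col_mx R 1 1 (n + n) (Z x) V))) ->
  smooth_field Z.
Proof.
move=> sZ k; case: (split_ordP k) => j ->.
  have := sZ (delta_mx 0 (rshift n j)).
  by under [X in smooth X -> _]eq_fun do rewrite canonical_form_p.
have := smoothN (sZ (delta_mx 0 (lshift n j))).
by under [X in smooth X -> _]eq_fun do rewrite canonical_form_q opprK.
Qed.

Section HitchinIntegrability.
Context {R : realType} {n : nat}.
Variables (omega : dform R (n + n) 2) (A : 'rV[R]_(n + n) -> 'End('rV[R]_(n + n))).
Hypothesis omega_smooth : smooth_form omega.
Local Notation Om x X Y := (canonical_form R n x (@col_mx R 1 1 (n + n) X Y)).
Local Notation om x X Y := (omega x (@col_mx R 1 1 (n + n) X Y)).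
Hypothesis AE : forall x X Y, Om x (A x X) Y = om x X Y.
Let J := gcs_matrix (canonical_form R n) A.

Lemma smooth_gcs_matrix (e : 'rV[R]_(n + n) -> TT R (n + n)) :
  smooth_section e -> smooth_section (fun x => J x (e x)).
Proof.
move=> [sX sxi]; have [lo _ so] := omega_smooth.
have [lO _ sO] := @smooth_canonical_form R n.
have sV := @smooth_const_field R (n + n) (n + n).
have sA Z : smooth_field Z -> smooth_field (fun x => A x (Z x)).
  move=> sZ; apply: smooth_field_canonical => V.
  under eq_fun do rewrite AE.
  exact: (smooth_form2 lo so sZ (sV V)).
split=> [|V].
  apply: smooth_field_canonical => V.
  have -> : (fun x => Om x (J x (e x)).1 V) = (fun x => om x (e x).1 V + (e x).2 V : R).
    by apply/funext => x; rewrite gcs_matrix1E AE.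
  apply: smoothD; last exact: sxi.
  exact: (smooth_form2 lo so sX (sV V)).
have -> : (fun x => (J x (e x)).2 V : R) = (fun x =>
    - (Om x (e x).1 V + Om x (A x (A x (e x).1)) V) - (e x).2 (A x V) : R).
  apply/funext => x; rewrite gcs_matrix2E.
  by rewrite (form2Dl (lO x)).
apply: smoothB; last by apply: smooth_covector_apply => //; exact: (sA (fun=> V)).
apply: smoothN; apply: smoothD; apply: (smooth_form2 lO sO _ (sV V)) => //.
by apply: (sA (fun x => A x (e x).1)); exact: sA.
Qed.

(** The vector part of the eigenvalue equation expresses the covector part of an
    eigenvector as the contraction of its vector part with s i Omega - omega.  The
    covector part of the equation then holds as well, because (s i)^2 = -1. *)
Lemma eigenbundle_graph (s : R) : s * s = 1 ->
  eigenbundle J (Complex 0 s) =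
  graph_form (fun x v => -1 * omega x v) (fun x v => s * canonical_form R n x v).
Proof.
move=> ss; apply/funext => x; apply/funext => -[u w]; apply/propext.
have [lO _ _] := @smooth_canonical_form R n.
rewrite /eigenbundle /scaleC /= !scale0r sub0r add0r.
have om_adj X Y : om x X (A x Y) = Om x (A x (A x X)) Y.
  by rewrite -AE -(hitchin_self_adjoint omega_smooth AE).
split=> [[Ju Jw] V|G].
  split.
    have := gcs_matrix1E A x u V; rewrite -/J Ju AE (form2Nl (lO x)) /=.
    by rewrite (form2Zl (lO x)) => E; rewrite !mulN1r E addKr.
  have := gcs_matrix1E A x w V; rewrite -/J Jw AE /=.
  by rewrite (form2Zl (lO x)) => ->; ring.
have Ju : J x u = - (s *: w).
  apply: gcs_matrixP => Y.
    have [-> _] := G Y; rewrite AE /= (form2Nl (lO x)) (form2Zl (lO x)); ring.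
  have [+ _] := G (A x Y); have [_] := G Y => /= Gw ->.
  rewrite opp_lfunE scale_lfunE /= Gw (form2Dl (lO x)) om_adj.
  rewrite -(hitchin_self_adjoint omega_smooth AE) !AE /GRing.scale /=.
  rewrite [s * (_ + _)]mulrDr [s * (s * _)]mulrA ss; ring.
have Jw : w = - (s *: J x u) by rewrite Ju scalerN opprK scalerA ss scale1r.
by congr Complex; rewrite // Jw linearN linearZ /= (gcs_matrix_sqr omega_smooth AE) scalerN opprK.
Qed.

Lemma gcs_matrix_integrable : closed_form omega -> integrable_gcs J.
Proof.
move=> omega_closed.
have graph_closed s : courant_closed
    (graph_form (fun x v => -1 * omega x v) (fun x v => s * canonical_form R n x v)).
  apply: courant_closed_graph_form.
  - exact: (smooth_formZ _ omega_smooth).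
  - exact: (closed_formZ _ omega_smooth omega_closed).
  - by apply: smooth_formZ; exact: smooth_canonical_form.
  - by apply: closed_formZ; [exact: smooth_canonical_form|exact: closed_canonical_form].
split; first split.
- exact: smooth_gcs_matrix.
- exact: (gcs_matrix_sqr omega_smooth AE).
- exact: (gcs_matrix_anti omega_smooth AE).
- by rewrite (eigenbundle_graph (s := 1)) ?mulr1.
- have -> : (- 'i)%C = Complex 0 (-1) :> R[i] by rewrite /GRing.opp /= oppr0.
  by rewrite (eigenbundle_graph (s := -1)) ?mulrNN ?mulr1.
Qed.

End HitchinIntegrability.

(** A is the composite of X |-> iota_X omega with the inverse of X |-> iota_X Omega. *)
Lemma hitchin_endomorphism {R : realType} {n : nat} (omega : dform R (n + n) 2) :
  smooth_form omega ->
  exists A : 'rV[R]_(n + n) -> 'End('rV[R]_(n + n)), forall x X Y,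
    canonical_form R n x (@col_mx R 1 1 (n + n) (A x X) Y)
    = omega x (@col_mx R 1 1 (n + n) X Y).
Proof.
move=> [lo _ _].
exists (fun x => linfun (fun X => sharp (flat omega x X))) => x X Y.
rewrite linfunE ?canonical_form_sharp ?flat_formE // => a U W.
by rewrite linearP sharp_linear.
Qed.

Theorem proposition1 (R : realType) (omega : dform R (2 + 2) 2)
  (omega_smooth : smooth_form omega) (omega_div : divergent_type omega) :
  let Omega := canonical_form R 2 in
  exists2 mu : 'rV[R]_(2 + 2) -> R, smooth mu &
    let omega' : dform R (2 + 2) 2 := fun x v => omega x v + mu x * Omega x v in
    [/\ forall f : 'rV[R]_2 -> R, smooth f ->
          forall x v, monge_ampere omega' f x v = monge_ampere omega f x v,
        hitchin_pair omega' Omega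
      & exists2 A : 'rV[R]_(2 + 2) -> 'End('rV[R]_(2 + 2)),
          unique (fun B => forall x v, omega' x v = twist Omega B x v) A
          & integrable_gcs (gcs_matrix Omega A)].
Proof.
move=> Omega.
have [mu smu closed'] := divergent_type_closed omega_smooth omega_div.
exists mu => // omega'.
have smooth' : smooth_form omega'.
  exact: (smooth_formD omega_smooth smu smooth_canonical_form).
have [A AE] := hitchin_endomorphism smooth'.
split.
- move=> f sf x v; have := pullback_canonical_form x v sf.
  rewrite /monge_ampere /pullback /omega' /Omega => ->.
  by rewrite mulr0 addr0.
- by split=> //; exact: symplectic_canonical_form.
exists A; last exact: (gcs_matrix_integrable smooth' AE closed').
have twistE B x (v : 'M[R]_(2, 2 + 2)) :
    twist Omega B x v = Omega x (@col_mx R 1 1 _ (B x (row 0 v)) (row 1 v)) by [].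
split=> [x v|B omegaB]; first by rewrite twistE /Omega AE col_mx_rows.
apply/funext => x; apply/lfunP => X; apply: (canonical_form_inj (x := x)) => Y.
by rewrite AE omegaB twistE row0_col_mx row1_col_mx.
Qed.
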